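(* Let $\mathbb F$ be an arbitrary field and let $L$ be a three-dimensional left Leibniz algebra over $\mathbb F$ which is not a Lie algebra. Then $L$ is isomorphic to one of the algebras $L_1,\dots,L_{16}$ (including parameterized families) listed in the context, and the automorphism group of each of these algebras is given as follows. Here an automorphism is identified with its matrix in the basis $a_1,a_2,a_3$ (the $j$-th column consists of the coordinates of the image of $a_j$), and all parameters without a stated restriction range over $\mathbb F$. 1. $\operatorname{Aut}(L_1)=\left\{\begin{pmatrix}a&0&0\\ b&d&0\\ c&e&a^2\end{pmatrix}: a,d\in\mathbb F^{\times},\ b,c,e\in\mathbb F\right\}$. 2. $\operatorname{Aut}(L_2)=\left\{\begin{pmatrix}a&0&0\\ b&a+b&0\\ c&d&a(a+b)\end{pmatrix}: a(a+b)\ne0\right\}$. 3. $\operatorname{Aut}(L_3(\alpha))$ with $\alpha\neq 1$ consists of all matrices $\begin{pmatrix}\alpha_1&0&0\\ \frac{\beta_2-\alpha_1}{1+\alpha}&\beta_2&0\\ \alpha_3&\beta_3&\alpha_1\beta_2\end{pmatrix}$ with $\alpha_1,\beta_2\in\mathbb F^{\times}$, $\alpha_3,\beta_3\in\mathbb F$. If $\alpha=1$, it consists of these matrices together with all matrices $\begin{pmatrix}\alpha_1&2\alpha_1&0\\ \alpha_2&-\alpha_1&0\\ \alpha_3&\beta_3&\alpha_1(\alpha_1+2\alpha_2)\end{pmatrix}$ with $\alpha_1(\alpha_1+2\alpha_2)\ne0$. The normal subgroup of all automorphisms inducing the identity on $L/\mathbb F a_3$ is isomorphic to $\mathbb F^{+}\times\mathbb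 F^{+}$ and has a complement, which is isomorphic to $\mathbb F^{\times}\times\mathbb F^{\times}$ if $\alpha\ne1$, and to a semidirect product of $\mathbb F^{\times}\times\mathbb F^{\times}$ by a group of order two if $\alpha=1$. 4. $\operatorname{Aut}(L_4)=\left\{\begin{pmatrix}\alpha_1&0&0\\ \alpha_2&\alpha_1&0\\ \alpha_3&\beta_3&\alpha_1^2\end{pmatrix}:\alpha_1\in\mathbb F^{\times},\ \alpha_2,\alpha_3,\beta_3\in\mathbb F\right\}$; it is a semidirect product of a normal subgroup isomorphic to $\mathbb F^{+}\times\mathbb F^{+}$ by a subgroup isomorphic to $\mathbb F^{+}\times\mathbb F^{\times}$. 5. $\operatorname{Aut}(L_5(\beta))=\left\{\begin{pmatrix}a&-\varepsilon\beta b&0\\ b&\varepsilon a&0\\ c&d&a^2+\beta b^2\end{pmatrix}:(a,b)\ne(0,0),\ \varepsilon^2=1,\ c,d\in\mathbb F\right\}$. 6. $\operatorname{Aut}(L_6(\delta))=\left\{\begin{pmatrix}\alpha_1&-\delta\alpha_2&0\\ \alpha_2&\alpha_1+\alpha_2&0\\ \alpha_3&\beta_3&\alpha_1^2+\alpha_1\alpha_2+\delta\alpha_2^2\end{pmatrix}:(\alpha_1,\alpha_2)\ne(0,0)\right\}$; it is a semidirect product of a normal subgroup isomorphic to $\mathbb F^{+}\times\mathbb F^{+}$ by a subgroup isomorphic to $E^{\times}$, where $E=\mathbb F(\theta)$ and $\theta^2-\theta+\delta=0$. 7. $\operatorname{Aut}(L_7)=\left\{\begin{pmatrix}1&0&0\\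 \alpha_2&\beta_2&0\\ \alpha_3&0&1\end{pmatrix}:\beta_2\in\mathbb F^{\times},\ \alpha_2,\alpha_3\in\mathbb F\right\}$; it is a direct product of a group isomorphic to $\mathbb F^{+}$ and a group isomorphic to $\mathbb F^{+}\rtimes\mathbb F^{\times}$ with the usual scalar action. 8. ($\operatorname{char}\mathbb F=2$.) $\operatorname{Aut}(L_8(\lambda))=\left\{\begin{pmatrix}1&0&0\\ \alpha_2&\beta_2&0\\ \alpha_3&\alpha_2\beta_2&\beta_2^2\end{pmatrix}:\beta_2\in\mathbb F^{\times},\ \alpha_2,\alpha_3\in\mathbb F,\ \alpha_2^2=\lambda(\beta_2^2-1)\right\}$. If $\lambda$ is not a square in $\mathbb F$, this group is isomorphic to $\mathbb F^{+}$. If $\lambda$ is a square in $\mathbb F$, it has a normal subgroup isomorphic to $\mathbb F^{+}$ and a complement isomorphic to $\mathbb F^{\times}$, where $u\in\mathbb F^{\times}$ acts by conjugation on $z\in\mathbb F^{+}$ as $z\mapsto u^2z$. 9. $\operatorname{Aut}(L_9)=\left\{\begin{pmatrix}1&0&0\\ \alpha_2&\beta_2&0\\ \gamma_3-1&0&\gamma_3\end{pmatrix}:\alpha_2\in\mathbb F,\ \beta_2,\gamma_3\in\mathbb F^{\times}\right\}$ (in every characteristic); it is a direct product of a group isomorphic to $\mathbb F^{\times}$ and a group isomorphic to $\mathbb F^{+}\rtimes\mathbb F^{\times}$ with the usual scalar action. 10. $\operatorname{Aut}(L_{10}(r))=\left\{\begin{pmatrix}1&0&0\\ \alpha_2&\beta_2&0\\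 \frac{\gamma_3-1}{r}&0&\gamma_3\end{pmatrix}:\alpha_2\in\mathbb F,\ \beta_2,\gamma_3\in\mathbb F^{\times}\right\}$; it is a direct product of a group isomorphic to $\mathbb F^{\times}$ and a group isomorphic to $\mathbb F^{+}\rtimes\mathbb F^{\times}$ with the usual scalar action. 11. ($\operatorname{char}\mathbb F\neq2$.) $\operatorname{Aut}(L_{11})=\left\{\begin{pmatrix}1&0&0\\ \alpha_2&\beta_2&0\\ -\frac{\alpha_2^2}{2}&-\alpha_2\beta_2&\beta_2^2\end{pmatrix}:\alpha_2\in\mathbb F,\ \beta_2\in\mathbb F^{\times}\right\}$; it is isomorphic to $\mathbb F^{+}\rtimes\mathbb F^{\times}$ with the usual scalar action. 12. $\operatorname{Aut}(L_{12})=\left\{\begin{pmatrix}a&0&0\\ b&a^2&0\\ c&ab&a^3\end{pmatrix}:a\in\mathbb F^{\times},\ b,c\in\mathbb F\right\}$. 13. $\operatorname{Aut}(L_{13})=\left\{\begin{pmatrix}1&0&0\\ b&1+b&0\\ c&b&1\end{pmatrix}:b\ne-1,\ c\in\mathbb F\right\}$. 14. $\operatorname{Aut}(L_{14}(\rho))$ is isomorphic to $GL_2(\mathbb F)$ if $\rho=1$; to $\mathbb F^{\times}\times\mathbb F^{\times}$ if $\rho\ne1$ and either $\operatorname{char}\mathbb F=2$ or $\rho\neq-1$; and, if $\operatorname{char}\mathbb F\ne2$ and $\rho=-1$, to a semidirect product of $\mathbb F^{\times}\times\mathbb F^{\times}$ by a group of order two which interchanges the two factors. 15. $\operatorname{Aut}(L_{15})=\left\{\begin{pmatrix}1&0&0\\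 a-1&a&0\\ b-a+1&b&a\end{pmatrix}:a\in\mathbb F^{\times},\ b\in\mathbb F\right\}$. 16. Let $E=\mathbb F(\theta)$ with $\theta^2=\gamma\theta+\beta$. If $\gamma\ne0$ or $\operatorname{char}\mathbb F=2$, then $\operatorname{Aut}(L_{16}(\beta,\gamma))$ consists of all matrices $\begin{pmatrix}1&0&0\\ b-\frac{\gamma(a-1)}{\beta}&a&\beta b\\ \frac{a-1}{\beta}&b&a+\gamma b\end{pmatrix}$ with $(a,b)\ne(0,0)$, and it is isomorphic to $E^{\times}$. If $\operatorname{char}\mathbb F\ne2$ and $\gamma=0$, it consists of these matrices together with all matrices $\begin{pmatrix}-1&0&0\\ -b&a&-\beta b\\ \frac{1-a}{\beta}&b&-a\end{pmatrix}$ with $(a,b)\ne(0,0)$, and it is a semidirect product of a normal subgroup isomorphic to $E^{\times}$ by a group of order two.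
   Context: A left Leibniz algebra over a field $\mathbb F$ is an $\mathbb F$-vector space $L$ with a bilinear product $[\cdot,\cdot]$ satisfying $[x,[y,z]]=[[x,y],z]+[y,[x,z]]$ for all $x,y,z\in L$. It is non-Lie if $[x,x]\neq0$ for some $x\in L$. An automorphism is an invertible linear map $f:L\to L$ with $f([x,y])=[f(x),f(y)]$ for all $x,y$; $\operatorname{Aut}(L)$ is the group of automorphisms. $\mathbb F^{+}$ is the additive group and $\mathbb F^{\times}$ the multiplicative group of $\mathbb F$; $E^\times$ is the multiplicative group of a field $E$. ''The usual scalar action'' of $\mathbb F^{\times}$ on $\mathbb F^{+}$ is $u\cdot b=ub$. ''A semidirect product of $A$ by $B$'' means that $A$ is normal and $B$ is a complement. The algebras below are three-dimensional over $\mathbb F$ with basis $a_1,a_2,a_3$; all products of basis elements not displayed are zero. - $L_1$: $[a_1,a_1]=a_3$. - $L_2$: $[a_1,a_1]=[a_1,a_2]=a_3$. - $L_3(\alpha)$, $\alpha\in\mathbb F$, $\alpha\ne0,-1$: $[a_1,a_1]=[a_2,a_1]=a_3$, $[a_1,a_2]=\alpha a_3$. - $L_4$: $[a_1,a_1]=[a_2,a_1]=a_3$, $[a_1,a_2]=-a_3$. - $L_5(\beta)$, $\beta\in\mathbb F$ with $X^2+\beta$ having no root in $\mathbb F$: $[a_1,a_1]=a_3$, $[a_2,a_2]=\beta a_3$. - $L_6(\delta)$, $\delta\in\mathbb F$ with $X^2+X+\delta$ having no root in $\mathbb F$: $[a_1,a_1]=[a_1,a_2]=a_3$, $[a_2,a_2]=\delta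 a_3$. - $L_7$: $[a_1,a_1]=a_3$, $[a_1,a_2]=a_2$, $[a_2,a_1]=-a_2$. - $L_8(\lambda)$, only when $\operatorname{char}\mathbb F=2$, $\lambda\in\mathbb F$: $[a_1,a_1]=\lambda a_3$, $[a_1,a_2]=[a_2,a_1]=a_2$, $[a_2,a_2]=a_3$. - $L_9$: $[a_1,a_1]=[a_1,a_3]=a_3$. - $L_{10}(r)$, $r\in\mathbb F^{\times}$: $[a_1,a_1]=a_3$, $[a_1,a_2]=a_2$, $[a_2,a_1]=-a_2$, $[a_1,a_3]=ra_3$. - $L_{11}$, only when $\operatorname{char}\mathbb F\ne2$: $[a_2,a_2]=a_3$, $[a_1,a_2]=a_2$, $[a_2,a_1]=-a_2$, $[a_1,a_3]=2a_3$. - $L_{12}$: $[a_1,a_1]=a_2$, $[a_1,a_2]=a_3$. - $L_{13}$: $[a_1,a_1]=a_2$, $[a_1,a_2]=a_2+a_3$. - $L_{14}(\rho)$, $\rho\in\mathbb F^{\times}$: $[a_1,a_1]=[a_1,a_2]=a_2$, $[a_1,a_3]=\rho a_3$. - $L_{15}$: $[a_1,a_1]=a_2$, $[a_1,a_2]=a_2+a_3$, $[a_1,a_3]=a_3$. - $L_{16}(\beta,\gamma)$, $\beta,\gamma\in\mathbb F$ with $X^2-\gamma X-\beta$ irreducible over $\mathbb F$: $[a_1,a_1]=a_2$, $[a_1,a_2]=a_3$, $[a_1,a_3]=\beta a_2+\gamma a_3$. *)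

(* Defs.v *)
From HB Require Import structures.
From mathcomp Require Import all_boot all_algebra all_field.
From mathcomp Require Import sesquilinear boolp classical_sets.

Set Implicit Arguments.
Unset Strict Implicit.
Unset Printing Implicit Defensive.

Import GRing.Theory.
Local Open Scope ring_scope.
Local Open Scope classical_set_scope.

(** MathComp's [{unit R}] needs a finite [R], so the group of units of an
    arbitrary ring is built here as a [groupType]:
    [units F] is the multiplicative group of a field and [units 'M[F]_n.+1] is
    the general linear group.  In MathComp
    [to_multiplicative F] is [F] with its addition as the group law. *)

Notation additive_group F := (Algebra.to_multiplicative F).

Record units (R : unitRingType) := Units {
  uval :> R;
  uvalP : uval \is a GRing.unit }.

HB.instance Definition _ (R : unitRingType) := [isSub for @uval R].
HB.instance Definition _ (R : unitRingType) := [Choice of units R by <:].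

Section UnitsGroup.
Variable R : unitRingType.
Implicit Types u v w : units R.

Definition units_one : units R := Units (unitr1 R).
Lemma units_inv_subproof u : (uval u)^-1 \is a GRing.unit.
Proof. by rewrite unitrV (uvalP u). Qed.
Definition units_inv u : units R := Units (units_inv_subproof u).
Lemma units_mul_subproof u v : uval u * uval v \is a GRing.unit.
Proof. by rewrite unitrMl ?(uvalP u) ?(uvalP v). Qed.
Definition units_mul u v : units R := Units (units_mul_subproof u v).

Lemma units_mulA : associative units_mul.
Proof. by move=> u v w; apply: val_inj; apply: mulrA. Qed.
Lemma units_mul1 : left_id units_one units_mul.
Proof. by move=> u; apply: val_inj; apply: mul1r. Qed.
Lemma units_mulr1 : right_id units_one units_mul.
Proof. by move=> u; apply: val_inj; apply: mulr1. Qed.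
Lemma units_mulV : left_inverse units_one units_inv units_mul.
Proof. by move=> u; apply: val_inj; apply: mulVr (uvalP u). Qed.
Lemma units_mulrV : right_inverse units_one units_inv units_mul.
Proof. by move=> u; apply: val_inj; apply: mulrV (uvalP u). Qed.

HB.instance Definition _ := isGroup.Build (units R)
  units_mulA units_mul1 units_mulr1 units_mulV units_mulrV.

End UnitsGroup.

(** The semidirect product of the additive group of [F] by its multiplicative
    group for the action [u . b = u * b]. *)

Definition scalar_sdprod (F : fieldType) : Type := (F * units F)%type.

HB.instance Definition _ (F : fieldType) := Choice.on (scalar_sdprod F).

Section ScalarSdprod.
Variable F : fieldType.
Implicit Types x y z : scalar_sdprod F.

Definition ssd_one : scalar_sdprod F := (0, 1%g).
Definition ssd_inv x : scalar_sdprod F := (- (uval (x.2^-1)%g * x.1), (x.2^-1)%g).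
Definition ssd_mul x y : scalar_sdprod F :=
  (x.1 + uval x.2 * y.1, (x.2 * y.2)%g).

Lemma ssd_mulA : associative ssd_mul.
Proof.
by move=> x y z; congr (_, _); rewrite /= ?mulgA // mulrDr addrA mulrA.
Qed.
Lemma ssd_mul1 : left_id ssd_one ssd_mul.
Proof. by case=> b u; congr (_, _); rewrite /= ?mul1g // mul1r add0r. Qed.
Lemma ssd_mulr1 : right_id ssd_one ssd_mul.
Proof. by case=> b u; congr (_, _); rewrite /= ?mulg1 // mulr0 addr0. Qed.
Lemma ssd_mulV : left_inverse ssd_one ssd_inv ssd_mul.
Proof. by case=> b u; congr (_, _); rewrite /= ?mulVg // addNr. Qed.
Lemma ssd_mulrV : right_inverse ssd_one ssd_inv ssd_mul.
Proof.
case=> b u; congr (_, _); rewrite /= ?mulgV //.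
by rewrite mulrN mulrA mulrV ?(uvalP u) // mul1r subrr.
Qed.

HB.instance Definition _ := isGroup.Build (scalar_sdprod F)
  ssd_mulA ssd_mul1 ssd_mulr1 ssd_mulV ssd_mulrV.

End ScalarSdprod.

(** Subgroups of a [groupType] are represented by sets of elements. *)

Section Subgroups.
Variable G : groupType.
Implicit Types A N K : set G.

Definition subgroup A :=
  A 1%g /\ (forall x y, A x -> A y -> A (x / y)%g).

Definition normal_subgroup N A :=
  [/\ subgroup N, N `<=` A & forall g n, A g -> N n -> N (g * n / g)%g].

(* [A] is the semidirect product of [N] by [K]: [N] is normal in [A] and [K] is
   a complement of [N] in [A]. *)
Definition semidirect A N K :=
  [/\ subgroup A, normal_subgroup N A, subgroup K & K `<=` A] /\
  (N `&` K = [set 1%g] /\ A = [set (n * k)%g | n in N & k in K]).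

Definition direct A N K := semidirect A N K /\ normal_subgroup K A.

Definition isomorphism (H : groupType) (f : H -> G) A :=
  [/\ {morph f : x y / (x * y)%g}, injective f & range f = A].

Definition isog A (H : groupType) := exists f : H -> G, isomorphism f A.

Definition order_two K :=
  subgroup K /\ exists2 s : G, s <> 1%g & K = [set 1%g; s].

End Subgroups.

Section Algebras.
Variable F : fieldType.

Definition left_leibniz (U : lmodType F) (mu : U -> U -> U) :=
  forall x y z, mu x (mu y z) = mu (mu x y) z + mu y (mu x z).

Definition non_lie (U : lmodType F) (mu : U -> U -> U) :=
  exists x, mu x x != 0.

Definition alg_isomorphism (U V : lmodType F) (mu : U -> U -> U)
    (nu : V -> V -> V) (f : {linear U -> V}) :=
  bijective f /\ forall x y, f (mu x y) = nu (f x) (f y).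

Definition alg_iso (U V : lmodType F) (mu : U -> U -> U) (nu : V -> V -> V) :=
  exists f : {linear U -> V}, alg_isomorphism mu nu f.

(* The linear map with matrix [M] is [x |-> M *m x] on column vectors, so that
   the j-th column of [M] consists of the coordinates of the image of a_j. *)
Definition Aut (mu : 'cV[F]_3 -> 'cV[F]_3 -> 'cV[F]_3) : set 'M[F]_3 :=
  [set M | alg_isomorphism mu mu (mulmx M)].

Definition AutG (mu : 'cV[F]_3 -> 'cV[F]_3 -> 'cV[F]_3)
    : set (units 'M[F]_3) :=
  [set g | Aut mu (uval g)].

Definition mx3 (x11 x12 x13 x21 x22 x23 x31 x32 x33 : F) : 'M[F]_3 :=
  \matrix_(i, j) nth 0 (nth [::] [:: [:: x11; x12; x13];
                                     [:: x21; x22; x23];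
                                     [:: x31; x32; x33]] i) j.

Definition a1 : 'cV[F]_3 := delta_mx 0 0.
Definition a2 : 'cV[F]_3 := delta_mx 1 0.
Definition a3 : 'cV[F]_3 := delta_mx ord_max 0.

(* The automorphisms inducing the identity on the quotient by the line of a_3. *)
Definition AutG_mod_a3 (mu : 'cV[F]_3 -> 'cV[F]_3 -> 'cV[F]_3)
    : set (units 'M[F]_3) :=
  [set g | AutG mu g /\
           forall x : 'cV[F]_3, exists c, uval g *m x - x = c *: a3].

(* The bilinear product with [a_i, a_j] = t i j, where i, j range over 1, 2, 3. *)
Definition product (t : nat -> nat -> 'cV[F]_3) (x y : 'cV[F]_3) : 'cV[F]_3 :=
  \sum_(i < 3) \sum_(j < 3) (x i 0 * y j 0) *: t i.+1 j.+1.

Definition L1 := product (fun i j => match i, j with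
  | 1, 1 => a3 | _, _ => 0 end).

Definition L2 := product (fun i j => match i, j with
  | 1, 1 => a3 | 1, 2 => a3 | _, _ => 0 end).

Definition L3 (alpha : F) := product (fun i j => match i, j with
  | 1, 1 => a3 | 2, 1 => a3 | 1, 2 => alpha *: a3 | _, _ => 0 end).

Definition L4 := product (fun i j => match i, j with
  | 1, 1 => a3 | 2, 1 => a3 | 1, 2 => - a3 | _, _ => 0 end).

Definition L5 (beta : F) := product (fun i j => match i, j with
  | 1, 1 => a3 | 2, 2 => beta *: a3 | _, _ => 0 end).

Definition L6 (delta : F) := product (fun i j => match i, j with
  | 1, 1 => a3 | 1, 2 => a3 | 2, 2 => delta *: a3 | _, _ => 0 end).

Definition L7 := product (fun i j => match i, j with
  | 1, 1 => a3 | 1, 2 => a2 | 2, 1 => - a2 | _, _ => 0 end).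

Definition L8 (lambda : F) := product (fun i j => match i, j with
  | 1, 1 => lambda *: a3 | 1, 2 => a2 | 2, 1 => a2 | 2, 2 => a3
  | _, _ => 0 end).

Definition L9 := product (fun i j => match i, j with
  | 1, 1 => a3 | 1, 3 => a3 | _, _ => 0 end).

Definition L10 (r : F) := product (fun i j => match i, j with
  | 1, 1 => a3 | 1, 2 => a2 | 2, 1 => - a2 | 1, 3 => r *: a3
  | _, _ => 0 end).

Definition L11 := product (fun i j => match i, j with
  | 2, 2 => a3 | 1, 2 => a2 | 2, 1 => - a2 | 1, 3 => 2%:R *: a3
  | _, _ => 0 end).

Definition L12 := product (fun i j => match i, j with
  | 1, 1 => a2 | 1, 2 => a3 | _, _ => 0 end).

Definition L13 := product (fun i j => match i, j with
  | 1, 1 => a2 | 1, 2 => a2 + a3 | _, _ => 0 end).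

Definition L14 (rho : F) := product (fun i j => match i, j with
  | 1, 1 => a2 | 1, 2 => a2 | 1, 3 => rho *: a3 | _, _ => 0 end).

Definition L15 := product (fun i j => match i, j with
  | 1, 1 => a2 | 1, 2 => a2 + a3 | 1, 3 => a3 | _, _ => 0 end).

Definition L16 (beta gamma : F) := product (fun i j => match i, j with
  | 1, 1 => a2 | 1, 2 => a3 | 1, 3 => beta *: a2 + gamma *: a3
  | _, _ => 0 end).

Definition L5_param (beta : F) := forall x : F, ~~ root ('X^2 + beta%:P) x.
Definition L6_param (delta : F) :=
  forall x : F, ~~ root ('X^2 + 'X + delta%:P) x.
Definition L16_param (beta gamma : F) :=
  irreducible_poly ('X^2 - gamma *: 'X - beta%:P).

End Algebras.

Arguments L1 {F}.
Arguments L2 {F}.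
Arguments L4 {F}.
Arguments L7 {F}.
Arguments L9 {F}.
Arguments L11 {F}.
Arguments L12 {F}.
Arguments L13 {F}.
Arguments L15 {F}.

(* Main.v *)
(** The span I of the squares [x, x] is a nonzero ideal which annihilates the
    algebra from the left, so it has dimension 1 or 2.

    If dim I = 2, take x with c = [x, x] nonzero: the algebra is determined by
    c and by the action of [x, -] on I.  If this action is scalar, the algebra
    is L_14(1).  Otherwise x can be changed so that x, [x, x], [x, [x, x]] is a
    basis, and the characteristic polynomial X^2 - gamma X - beta of the action
    decides between L_12, L_13, L_14, L_15 and, when it is irreducible, L_16.

    If I is spanned by c, the quotient by I is a Lie algebra of dimension 2.
    When it is abelian the product is a bilinear form with values in I, which
    gives L_1 to L_6, according to its degeneracy and isotropy, if [z, c] = 0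
    for all z, and L_9 otherwise.  When it is not abelian, one
    can choose x and y with [x, y] = y = - [y, x], and the Leibniz identity
    leaves L_7, L_8, L_10 and L_11.

    Automorphisms are found by solving the equations which say that a matrix
    respects the products of the basis vectors.  The complements and normal
    subgroups are images of explicit matrix representations. *)

Require Import Defs.
From HB Require Import structures.
From mathcomp Require Import all_boot all_algebra all_field.
From mathcomp Require Import sesquilinear boolp classical_sets.
From mathcomp Require Import ring.

Set Implicit Arguments.
Unset Strict Implicit.
Unset Printing Implicit Defensive.

Import GRing.Theory.
Local Open Scope ring_scope.
Local Open Scope classical_set_scope.

(** * Coordinates *)

(** Many matrices below look ad hoc only because a_1 is an awkward basis vector. In L_9, L_10, L_14,
    L_16, and in L_8 for square lambda, some vector v, equal to a_1 plus a combination of a_2 and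
    a_3, has square zero: a_1 - a_3 / r in L_10, for instance, or a_1 - a_2 in L_14. The
    representing matrices fix v, and next to it they are diagonal, arbitrary, or multiplications of
    E. Entries such as (gamma_3 - 1) / r or (a - 1) / beta appear when v is rewritten in terms of
    a_1, a_2, a_3.

    If dim I = 2, let A be the action of a_1 on I, P the restriction of an automorphism to I, and p
    the a_1-coordinate of the image of a_1. Then P A = p A P, so multiplication by p permutes the
    eigenvalues of A. This restricts p, and explains why extra automorphisms occur only when A has
    eigenvalues of the form t, -t.

    The classification never forms I as a subspace. It fixes one nonzero square c and asks whether
    some square d is not a multiple of c; the Leibniz identity then puts all the products that
    matter into the span of c, or of c and d. *)

Section Coordinates.
Variable F : fieldType.

Definition col3 (x y z : F) : 'cV[F]_3 := \col_i nth 0 [:: x; y; z] i.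

Lemma col3_eta (v : 'cV[F]_3) : v = col3 (v 0 0) (v 1 0) (v ord_max 0).
Proof.
apply/colP=> -[[|[|[|//]]] Hi]; rewrite mxE /=; congr (v _ _); exact: val_inj.
Qed.

Lemma col3P (v : 'cV[F]_3) : exists x y z, v = col3 x y z.
Proof. by exists (v 0 0), (v 1 0), (v ord_max 0); exact: col3_eta. Qed.

Lemma col3_inj x y z x' y' z' :
  col3 x y z = col3 x' y' z' -> [/\ x = x', y = y' & z = z'].
Proof.
by move/colP=> E; split; [have := E 0|have := E 1|have := E ord_max];
  rewrite !mxE.
Qed.

Lemma col3D x y z x' y' z' :
  col3 x y z + col3 x' y' z' = col3 (x + x') (y + y') (z + z').
Proof. by apply/colP=> -[[|[|[|//]]] Hi]; rewrite !mxE. Qed.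

Lemma col3N x y z : - col3 x y z = col3 (- x) (- y) (- z).
Proof. by apply/colP=> -[[|[|[|//]]] Hi]; rewrite !mxE. Qed.

Lemma col3Z k x y z : k *: col3 x y z = col3 (k * x) (k * y) (k * z).
Proof. by apply/colP=> -[[|[|[|//]]] Hi]; rewrite !mxE. Qed.

Lemma col30 : 0 = col3 0 0 0.
Proof. by apply/colP=> -[[|[|[|//]]] Hi]; rewrite !mxE. Qed.

Lemma a1E : a1 F = col3 1 0 0.
Proof. by apply/colP=> -[[|[|[|//]]] Hi]; rewrite !mxE. Qed.

Lemma a2E : a2 F = col3 0 1 0.
Proof. by apply/colP=> -[[|[|[|//]]] Hi]; rewrite !mxE. Qed.

Lemma a3E : a3 F = col3 0 0 1.
Proof. by apply/colP=> -[[|[|[|//]]] Hi]; rewrite !mxE. Qed.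

Definition col3E := (a1E, a2E, a3E, col30, col3N, col3Z, col3D).

Lemma product_col3 t x1 x2 x3 y1 y2 y3 :
  product t (col3 x1 x2 x3) (col3 y1 y2 y3) =
  (x1 * y1) *: t 1 1 + (x1 * y2) *: t 1 2 + (x1 * y3) *: t 1 3
  + ((x2 * y1) *: t 2 1 + (x2 * y2) *: t 2 2 + (x2 * y3) *: t 2 3)
  + ((x3 * y1) *: t 3 1 + (x3 * y2) *: t 3 2 + (x3 * y3) *: t 3 3) :> 'cV[F]_3.
Proof.
by rewrite /product !big_ord_recr !big_ord0 /= !mxE /= !add0r.
Qed.

Lemma mul_mx3_col3 x11 x12 x13 x21 x22 x23 x31 x32 x33 x y z :
  mx3 x11 x12 x13 x21 x22 x23 x31 x32 x33 *m col3 x y z =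
  col3 (x11 * x + x12 * y + x13 * z) (x21 * x + x22 * y + x23 * z)
       (x31 * x + x32 * y + x33 * z) :> 'cV[F]_3.
Proof.
by apply/colP=> -[[|[|[|//]]] Hi];
  rewrite mxE !big_ord_recr big_ord0 /= !mxE /= add0r.
Qed.

Lemma mulmx_mx3 x11 x12 x13 x21 x22 x23 x31 x32 x33
    y11 y12 y13 y21 y22 y23 y31 y32 y33 :
  mx3 x11 x12 x13 x21 x22 x23 x31 x32 x33 *m
  mx3 y11 y12 y13 y21 y22 y23 y31 y32 y33 =
  mx3 (x11 * y11 + x12 * y21 + x13 * y31) (x11 * y12 + x12 * y22 + x13 * y32)
      (x11 * y13 + x12 * y23 + x13 * y33)
      (x21 * y11 + x22 * y21 + x23 * y31) (x21 * y12 + x22 * y22 + x23 * y32)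
      (x21 * y13 + x22 * y23 + x23 * y33)
      (x31 * y11 + x32 * y21 + x33 * y31) (x31 * y12 + x32 * y22 + x33 * y32)
      (x31 * y13 + x32 * y23 + x33 * y33) :> 'M[F]_3.
Proof.
by apply/matrixP=> -[[|[|[|//]]] Hi] -[[|[|[|//]]] Hj];
  rewrite mxE !big_ord_recr big_ord0 /= !mxE /= add0r.
Qed.

Lemma mul_mx3 x11 x12 x13 x21 x22 x23 x31 x32 x33
    y11 y12 y13 y21 y22 y23 y31 y32 y33 :
  mx3 x11 x12 x13 x21 x22 x23 x31 x32 x33 *
  mx3 y11 y12 y13 y21 y22 y23 y31 y32 y33 =
  mx3 (x11 * y11 + x12 * y21 + x13 * y31) (x11 * y12 + x12 * y22 + x13 * y32)
      (x11 * y13 + x12 * y23 + x13 * y33)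
      (x21 * y11 + x22 * y21 + x23 * y31) (x21 * y12 + x22 * y22 + x23 * y32)
      (x21 * y13 + x22 * y23 + x23 * y33)
      (x31 * y11 + x32 * y21 + x33 * y31) (x31 * y12 + x32 * y22 + x33 * y32)
      (x31 * y13 + x32 * y23 + x33 * y33) :> 'M[F]_3.
Proof. exact: mulmx_mx3. Qed.

Lemma mx3_1 : 1 = mx3 1 0 0 0 1 0 0 0 1 :> 'M[F]_3.
Proof.
by apply/matrixP=> -[[|[|[|//]]] Hi] -[[|[|[|//]]] Hj]; rewrite !mxE.
Qed.

Lemma mx3P (M : 'M[F]_3) : exists x11 x12 x13 x21 x22 x23 x31 x32 x33,
  M = mx3 x11 x12 x13 x21 x22 x23 x31 x32 x33.
Proof.
exists (M 0 0), (M 0 1), (M 0 ord_max), (M 1 0), (M 1 1), (M 1 ord_max).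
exists (M ord_max 0), (M ord_max 1), (M ord_max ord_max).
by apply/matrixP=> -[[|[|[|//]]] Hi] -[[|[|[|//]]] Hj]; rewrite mxE /=;
  congr (M _ _); exact: val_inj.
Qed.

Lemma mx3_inj x11 x12 x13 x21 x22 x23 x31 x32 x33
    y11 y12 y13 y21 y22 y23 y31 y32 y33 :
  mx3 x11 x12 x13 x21 x22 x23 x31 x32 x33 =
  mx3 y11 y12 y13 y21 y22 y23 y31 y32 y33 :> 'M[F]_3 ->
  [/\ [/\ x11 = y11, x12 = y12 & x13 = y13], [/\ x21 = y21,
    x22 = y22 & x23 = y23]
    & [/\ x31 = y31, x32 = y32 & x33 = y33]].
Proof.
move/matrixP=> E; split; split.
all: [> have := E 0 0|have := E 0 1|have := E 0 ord_max
      |have := E 1 0|have := E 1 1|have := E 1 ord_max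
      |have := E ord_max 0|have := E ord_max 1|have := E ord_max ord_max].
all: by rewrite !mxE.
Qed.

Lemma unit_mx3 x11 x12 x13 x21 x22 x23 x31 x32 x33 :
  (mx3 x11 x12 x13 x21 x22 x23 x31 x32 x33 \in unitmx) =
  (x11 * (x22 * x33 - x23 * x32) - x12 * (x21 * x33 - x23 * x31)
   + x13 * (x21 * x32 - x22 * x31) != 0 :> F).
Proof.
rewrite unitmxE unitfE; congr (_ != _).
rewrite (expand_det_row _ 0) !big_ord_recr big_ord0 /= /cofactor.
rewrite !(expand_det_row _ (0 : 'I_2)) !big_ord_recr !big_ord0 /= /cofactor.
by rewrite !det_mx11 !mxE /=; ring.
Qed.

End Coordinates.

(** * Bilinear products given by tables: homomorphisms and changes of basis *)

Section Product.
Variable F : fieldType.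
Implicit Types (t : nat -> nat -> 'cV[F]_3) (M : 'M[F]_3).

Lemma productDl t u v w : product t (u + v) w = product t u w + product t v w.
Proof.
rewrite /product -big_split; apply: eq_bigr => i _; rewrite -big_split.
by apply: eq_bigr => j _; rewrite mxE mulrDl scalerDl.
Qed.

Lemma productDr t u v w : product t u (v + w) = product t u v + product t u w.
Proof.
rewrite /product -big_split; apply: eq_bigr => i _; rewrite -big_split.
by apply: eq_bigr => j _; rewrite mxE mulrDr scalerDl.
Qed.

Lemma productZl t k u v : product t (k *: u) v = k *: product t u v.
Proof.
rewrite /product scaler_sumr; apply: eq_bigr => i _; rewrite scaler_sumr.
by apply: eq_bigr => j _; rewrite mxE -mulrA scalerA.
Qed.

Lemma productZr t k u v : product t u (k *: v) = k *: product t u v.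
Proof.
rewrite /product scaler_sumr; apply: eq_bigr => i _; rewrite scaler_sumr.
by apply: eq_bigr => j _; rewrite mxE mulrCA scalerA.
Qed.

Lemma eq_product t t' :
  (forall i j : 'I_3, t i.+1 j.+1 = t' i.+1 j.+1) -> product t = product t'.
Proof.
move=> E; apply: funext => x; apply: funext => y.
by apply: eq_bigr => i _; apply: eq_bigr => j _; rewrite E.
Qed.

(** By bilinearity it is enough to compare products of basis vectors. Two tables are allowed so that
    the criterion serves both automorphisms and changes of basis. *)
Lemma hom_mx3 t t' x11 x12 x13 x21 x22 x23 x31 x32 x33 :
  let M := mx3 x11 x12 x13 x21 x22 x23 x31 x32 x33 in
  let u := col3 x11 x21 x31 in
  let v := col3 x12 x22 x32 in
  let w := col3 x13 x23 x33 in
  [/\ [/\ M *m t' 1 1 = product t u u, M *m t' 1 2 = product t u v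
        & M *m t' 1 3 = product t u w],
      [/\ M *m t' 2 1 = product t v u, M *m t' 2 2 = product t v v
        & M *m t' 2 3 = product t v w]
    & [/\ M *m t' 3 1 = product t w u, M *m t' 3 2 = product t w v
        & M *m t' 3 3 = product t w w]] <->
  forall x y, M *m product t' x y = product t (M *m x) (M *m y).
Proof.
move=> M u v w; split.
  move=> [[E11 E12 E13] [E21 E22 E23] [E31 E32 E33]] x y.
  have Mcol x1 x2 x3 : M *m col3 x1 x2 x3 = x1 *: u + x2 *: v + x3 *: w.
    by rewrite mul_mx3_col3 !col3E; congr col3; ring.
  have [x1 [x2 [x3 ->]]] := col3P x; have [y1 [y2 [y3 ->]]] := col3P y.
  rewrite product_col3 !Mcol !(productDl, productDr) !(productZl, productZr).
  by rewrite !mulmxDr -!scalemxAr E11 E12 E13 E21 E22 E23 E31 E32 E33 !scalerA.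
move=> E; have := (E (a1 F) (a1 F), E (a1 F) (a2 F), E (a1 F) (a3 F),
  (E (a2 F) (a1 F), E (a2 F) (a2 F), E (a2 F) (a3 F)),
  (E (a3 F) (a1 F), E (a3 F) (a2 F), E (a3 F) (a3 F))).
have Ma1 : M *m a1 F = u.
  by rewrite !col3E mul_mx3_col3; congr col3; ring.
have Ma2 : M *m a2 F = v.
  by rewrite !col3E mul_mx3_col3; congr col3; ring.
have Ma3 : M *m a3 F = w.
  by rewrite !col3E mul_mx3_col3; congr col3; ring.
rewrite Ma1 Ma2 Ma3 a1E a2E a3E !(product_col3 t').
rewrite !(mul1r, mul0r, mulr0, scale0r, scale1r, addr0, add0r).
by case=> [[[[? ?] ?] [[? ?] ?]] [[? ?] ?]].
Qed.

Lemma mulmx_bij M : bijective (mulmx M : 'cV[F]_3 -> 'cV[F]_3) <-> M \in unitmx.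
Proof.
split=> [[g gK Kg]|uM]; last first.
  by exists (mulmx (invmx M)); [exact: mulKmx|exact: mulKVmx].
(* A row of the left kernel of [M^T] is, transposed, a column killed by [M]; injectivity makes it
   zero. *)
rewrite -unitmx_tr -row_free_unit -kermx_eq0; apply/eqP/row_matrixP => i.
have /sub_kermxP E := row_sub i (kermx M^T).
rewrite row0 -[LHS]trmxK; suff -> : (row i (kermx M^T))^T = 0 by rewrite trmx0.
by apply: (can_inj gK); rewrite mulmx0 -[LHS]trmxK trmx_mul trmxK E trmx0.
Qed.

Lemma AutP t M : Aut (product t) M <-> M \in unitmx /\
  forall x y, M *m product t x y = product t (M *m x) (M *m y).
Proof. by split=> -[/mulmx_bij]. Qed.

(** The columns of [M] are the new basis vectors in the old coordinates, and [t'] is the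
    multiplication table that they obey. *)
Lemma alg_iso_change_basis (L : lmodType F) (br : L -> L -> L) t t' M :
  M \in unitmx ->
  (forall x y, M *m product t' x y = product t (M *m x) (M *m y)) ->
  alg_iso br (product t) -> alg_iso br (product t').
Proof.
move=> uM hM [f [bf hf]]; exists (mulmx (invmx M) \o f); split.
  apply: bij_comp bf; apply/mulmx_bij; by rewrite unitmx_inv.
move=> x y /=; rewrite hf; apply: (can_inj (mulKmx uM)).
by rewrite hM !mulKVmx.
Qed.

End Product.

(** * Criteria for semidirect products of matrix groups *)

Section Groups.
Variable G : groupType.
Implicit Types A N K : set G.

Lemma subgroupM A x y : subgroup A -> A x -> A y -> A (x * y)%g.
Proof.
move=> [A1 AV] Ax Ay; rewrite -[y]invgK -[(y^-1)%g]mul1g.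
by apply: (AV) => //; exact: AV.
Qed.

Lemma isomorphism1 (H : groupType) (f : H -> G) A :
  isomorphism f A -> f 1%g = 1%g.
Proof.
by move=> [fM _ _]; apply: (mulgI (f 1%g)); rewrite -fM !mulg1.
Qed.

Lemma isomorphismV (H : groupType) (f : H -> G) A x :
  isomorphism f A -> f (x^-1)%g = ((f x)^-1)%g.
Proof.
move=> fA; have [fM _ _] := fA; apply: (mulgI (f x)).
by rewrite -fM !mulgV (isomorphism1 fA).
Qed.

Lemma subgroup_range (H : groupType) (f : H -> G) A :
  isomorphism f A -> subgroup A.
Proof.
move=> fA; have [fM _ rf] := fA; rewrite -rf; split.
  by exists 1%g => //; exact: isomorphism1 fA.
move=> _ _ [x _ <-] [y _ <-]; exists (x / y)%g => //.
by rewrite fM (isomorphismV _ fA).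
Qed.

Lemma isog_subgroup (H : groupType) A : isog A H -> subgroup A.
Proof. by move=> [f]; exact: subgroup_range. Qed.

(** Conjugation by [n * k] is conjugation by [k] followed by conjugation inside [N], so normality
    has only to be tested on [K]. *)
Lemma semidirectI A N K : subgroup A -> subgroup N -> subgroup K ->
  N `<=` A -> K `<=` A ->
  (forall k n, K k -> N n -> N (k * n / k)%g) ->
  (forall g, N g -> K g -> g = 1%g) ->
  (forall g, A g -> exists n k, [/\ N n, K k & g = (n * k)%g]) ->
  semidirect A N K.
Proof.
move=> sA sN sK NA KA nNK tNK gNK; split; split=> //.
- split=> // g n /gNK[n' [k [Nn' Kk ->]]] Nn.
  have -> : (n' * k * n / (n' * k) = n' * (k * n / k) / n')%g.
    by rewrite invgM !mulgA.
  apply: (proj2 sN) => //; apply: subgroupM => //; exact: nNK.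
- apply/seteqP; split=> [g [Ng Kg]|_ ->]; first exact: tNK.
  by split; [case: sN|case: sK].
- apply/seteqP; split=> [g /gNK[n [k [Nn Kk ->]]]|_ [n Nn [k Kk <-]]].
    by exists n => //; exists k.
  by apply: subgroupM; [|exact: NA|exact: KA].
Qed.

(** Since [N] and [K] commute, [n * k'] acts on [K] by conjugation as [k'] does; hence [K] is normal
    too. *)
Lemma directI A N K : subgroup A -> subgroup N -> subgroup K ->
  N `<=` A -> K `<=` A ->
  (forall k n, K k -> N n -> (k * n = n * k)%g) ->
  (forall g, N g -> K g -> g = 1%g) ->
  (forall g, A g -> exists n k, [/\ N n, K k & g = (n * k)%g]) ->
  direct A N K.
Proof.
move=> sA sN sK NA KA cNK tNK gNK; split.
  by apply: semidirectI => // k n Kk Nn; rewrite (cNK k) // mulgK.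
split=> // g k /gNK[n [k' [Nn Kk' ->]]] Kk.
have Kk'' : K (k' * k / k')%g by apply: (proj2 sK) => //; exact: subgroupM.
have -> : (n * k' * k / (n * k') = n * (k' * k / k') / n)%g.
  by rewrite invgM !mulgA.
by rewrite -(cNK _ n) // mulgK.
Qed.

Lemma order_twoI (s : G) : (s * s = 1)%g -> s <> 1%g -> order_two [set 1%g; s].
Proof.
move=> ss s1; split; last by exists s.
have sV : (s^-1 = s)%g by apply: (mulgI s); rewrite mulgV.
split; first by left.
move=> x y [->|->] [->|->]; rewrite ?invg1 ?sV ?mulg1 ?mul1g ?ss;
  by [left|right].
Qed.

End Groups.

(** * Subgroups of GL_3 as images of faithful matrix representations *)

Section MatrixGroups.
Variable F : fieldType.
Notation GL3 := (units 'M[F]_3).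

(** The identity is a default value for singular matrices; the matrices supplied below are
    invertible. *)
Definition unit_of (M : 'M[F]_3) : GL3 := insubd (1%g : GL3) M.

Lemma val_unit_of M : M \in unitmx -> uval (unit_of M) = M.
Proof. by move=> uM; rewrite /unit_of val_insubd ifT. Qed.

Lemma uval_inj : injective (@uval 'M[F]_3).
Proof. exact: val_inj. Qed.

Lemma uval_eq1 (g : GL3) : uval g = 1 -> g = 1%g.
Proof. by move=> E; apply: uval_inj. Qed.

Lemma uvalM (g h : GL3) : uval (g * h)%g = uval g * uval h.
Proof. by []. Qed.

Lemma uval_mul (g h : GL3) A B : uval g = A -> uval h = B ->
  uval (g * h)%g = A *m B.
Proof. by move=> <- <-. Qed.

(** A quotient is recognised by a multiplication, so that no inverse matrix has to be computed. *)
Lemma uval_div (g h : GL3) A : A *m uval h = uval g -> uval (g / h)%g = A.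
Proof.
move=> E; apply: (can_inj (mulmxK (uvalP h))); rewrite E.
by apply/esym/(etrans (congr1 (@uval _) (esym (divgK h g)))).
Qed.

Section Representation.
Variables (H : groupType) (m : H -> 'M[F]_3).
Hypotheses (m1 : m 1%g = 1) (mM : forall x y, m (x * y)%g = m x * m y).

Lemma rep_unitmx h : m h \in unitmx.
Proof.
have := mM h (h^-1)%g; rewrite mulgV m1 => E.
by have [] := mulmx1_unit (esym E).
Qed.

Lemma uval_rep h : uval (unit_of (m h)) = m h.
Proof. exact/val_unit_of/rep_unitmx. Qed.

Lemma isomorphism_rep (A : set GL3) : injective m ->
  (forall g, A g <-> exists h, uval g = m h) ->
  isomorphism (fun h => unit_of (m h)) A.
Proof.
move=> m_inj mA; split.
- by move=> x y; apply: uval_inj; rewrite uvalM !uval_rep.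
- by move=> x y /(congr1 (@uval _)); rewrite !uval_rep => /m_inj.
apply/seteqP; split=> [_ [h _ <-]|g /mA[h E]].
  by apply/mA; exists h; rewrite uval_rep.
by exists h => //; apply: uval_inj; rewrite uval_rep.
Qed.

Lemma isog_rep (A : set GL3) : injective m ->
  (forall g, A g <-> exists h, uval g = m h) -> isog A H.
Proof. by move=> *; eexists; exact: isomorphism_rep. Qed.

End Representation.

Lemma subgroup_AutG t : subgroup (AutG (product t : 'cV[F]_3 -> _)).
Proof.
split; first by apply/AutP; split; [exact: unitmx1|move=> x y; rewrite !mul1mx].
move=> g h /AutP[ug hg] /AutP[uh hh]; apply/AutP; split.
  exact: (uvalP (g / h)%g).
have hV u v : (uval h)^-1 *m product t u v
    = product t ((uval h)^-1 *m u) ((uval h)^-1 *m v).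
  by apply: (can_inj (mulKmx uh)); rewrite hh !mulKVmx.
have -> : uval (g / h)%g = uval g *m (uval h)^-1 by [].
by move=> x y; rewrite -!mulmxA hV hg.
Qed.

End MatrixGroups.

(** * Algebras given by a bilinear form: L_1 to L_6 *)

Ltac scalar_simp :=
  rewrite ?(mulr0, mul0r, mulr1, mul1r, oppr0, addr0, add0r, subr0, sub0r).

Ltac col3_simp :=
  rewrite ?product_col3 /= ?(mulmx0, scaler0, addr0, add0r);
  rewrite ?(a1E, a2E, a3E) ?(mul_mx3_col3, col3N, col3Z, col3D) ?col30;
  rewrite ?(mulr0, mul0r, mulr1, mul1r, oppr0, addr0, add0r).

Ltac hom_entries := apply/hom_mx3; split; split; col3_simp; congr col3.

(* Equations are simplified one at a time because rewriting in the whole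
   conjunction is quadratic in its size. *)
Ltac aut_intro M :=
  move=> /AutP[];
  have [x11 [x12 [x13 [x21 [x22 [x23 [x31 [x32 [x33 ->]]]]]]]]] := mx3P M;
  rewrite unit_mx3 => uM /hom_mx3;
  let H11 := fresh in let H12 := fresh in let H13 := fresh in
  let H21 := fresh in let H22 := fresh in let H23 := fresh in
  let H31 := fresh in let H32 := fresh in let H33 := fresh in
  intros [[H11 H12 H13] [H21 H22 H23] [H31 H32 H33]];
  revert H11; col3_simp; intro H11;
  revert H12; col3_simp; intro H12;
  revert H13; col3_simp; intro H13;
  revert H21; col3_simp; intro H21;
  revert H22; col3_simp; intro H22;
  revert H23; col3_simp; intro H23;
  revert H31; col3_simp; intro H31;
  revert H32; col3_simp; intro H32;
  revert H33; col3_simp; intro H33;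
  generalize (And3 (And3 H11 H12 H13) (And3 H21 H22 H23) (And3 H31 H32 H33));
  clear H11 H12 H13 H21 H22 H23 H31 H32 H33.

(** The nonvanishing of the determinant is left as a goal, while [tac] proves the coordinates of the
    nine product equations. *)
Ltac aut_elim tac := apply/AutP; split;
  [rewrite unit_mx3; scalar_simp|by hom_entries; tac].

Ltac change_basis M iso tac := apply: (alg_iso_change_basis (M := M) _ _ iso);
  [rewrite unit_mx3; scalar_simp|by hom_entries; tac].

Section FormAlgebras.
Variable F : fieldType.

Definition form_alg (b11 b12 b21 b22 : F) :=
  product (fun i j => match i, j with
  | 1, 1 => b11 *: a3 F | 1, 2 => b12 *: a3 F
  | 2, 1 => b21 *: a3 F | 2, 2 => b22 *: a3 F
  | _, _ => 0 end).

Lemma mulr_eq0_l (x y : F) : y != 0 -> x * y = 0 -> x = 0.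
Proof. by move=> y0 /eqP; rewrite mulf_eq0 (negPf y0) orbF => /eqP. Qed.

Lemma mulf_neq0P (x y : F) : x * y != 0 -> x != 0 /\ y != 0.
Proof. by rewrite mulf_eq0 negb_or => /andP. Qed.

Section Form.
Variables b11 b12 b21 b22 : F.
Hypothesis form_neq0 : [|| b11 != 0, b12 != 0, b21 != 0 | b22 != 0].
Notation mu := (form_alg b11 b12 b21 b22).

(** Some entry of the form can be cancelled. This keeps the image of a_3 on its own line, and forces
    the multiplier to be 1 for maps that are trivial modulo a_3. *)
Lemma form_mulr_inj (x y : F) :
  x * b11 = y * b11 -> x * b12 = y * b12 -> x * b21 = y * b21 ->
  x * b22 = y * b22 -> x = y.
Proof.
move=> E1 E2 E3 E4.
by case/or4P: form_neq0 => /mulIf; apply.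
Qed.

(** With [P] the block on L / F a_3 and [B] the matrix of the form, the equations say P^T B P = e B.
    Automorphisms are thus similitudes of the form with multiplier [e], extended by an arbitrary row
    [x, y]. *)
Lemma Aut_form_alg :
  Aut mu = [set M | exists a b c d x y e : F,
    [/\ M = mx3 a b 0 c d 0 x y e, e != 0 /\ a * d - b * c != 0,
        b11 * a * a + b12 * a * c + b21 * c * a + b22 * c * c = e * b11 /\
        b11 * a * b + b12 * a * d + b21 * c * b + b22 * c * d = e * b12 &
        b11 * b * a + b12 * b * c + b21 * d * a + b22 * d * c = e * b21 /\
        b11 * b * b + b12 * b * d + b21 * d * b + b22 * d * d = e * b22]].
Proof.
apply/seteqP; split=> M.
  aut_intro M.
  move=> [[/col3_inj[E1 E2 E3] /col3_inj[E4 E5 E6] _]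
    [/col3_inj[E7 E8 E9] /col3_inj[E10 E11 E12] _] _].
  have x13_0 : x13 = 0 by apply: form_mulr_inj; rewrite mul0r.
  have x23_0 : x23 = 0 by apply: form_mulr_inj; rewrite mul0r.
  have /mulf_neq0P[x33_0 det0] : x33 * (x11 * x22 - x12 * x21) != 0.
    by move: uM; rewrite x13_0 x23_0; congr (_ != _); ring.
  exists x11, x12, x21, x22, x31, x32, x33; rewrite x13_0 x23_0.
  by rewrite E3 E6 E9 E12; split=> //; split; ring.
move=> [a [b [c [d [x [y [e [-> [e0 det0] [E1 E2] [E3 E4]]]]]]]]].
apply/AutP; split.
  rewrite unit_mx3; move: (mulf_neq0 e0 det0); congr (_ != _); ring.
hom_entries; rewrite ?(=^~ E1, =^~ E2, =^~ E3, =^~ E4); ring.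
Qed.

Lemma AutG_form_alg_mod_a3 (g : units 'M[F]_3) :
  AutG_mod_a3 mu g <-> exists x y, uval g = mx3 1 0 0 0 1 0 x y 1.
Proof.
split=> [[]|[x [y Eg]]].
  rewrite /AutG /= Aut_form_alg =>
    -[a [b [c [d [x [y [e [-> _ [E1 E2] [E3 E4]]]]]]]]] E.
  have [k1] := E (a1 F); have [k2] := E (a2 F).
  col3_simp; move=> /col3_inj[b0 d1 _] /col3_inj[a1 c0 _].
  move: E1 E2 E3 E4; rewrite -(subrK 1 d) -(subrK 1 a) d1 a1 b0 c0 add0r.
  rewrite !(mulr0, mulr1, mul0r, addr0, add0r) => E1 E2 E3 E4.
  exists x, y; suff -> : e = 1 by [].
  by apply: form_mulr_inj; rewrite mul1r.
split.
  rewrite /AutG /= Aut_form_alg; exists 1, 0, 0, 1, x, y, 1; rewrite Eg.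
  by split=> //; rewrite ?(mulr0, mulr1, mul0r, subr0) ?oner_neq0 //; split;
    ring.
move=> v; have [v1 [v2 [v3 ->]]] := col3P v; exists (x * v1 + y * v2).
by rewrite Eg; col3_simp; congr col3; ring.
Qed.

Lemma isog_AutG_form_alg_mod_a3 :
  isog (AutG_mod_a3 mu) (additive_group F * additive_group F)%type.
Proof.
pose m (h : additive_group F * additive_group F) : 'M[F]_3 :=
  mx3 1 0 0 0 1 0 (h.1 : F) (h.2 : F) 1.
apply: (@isog_rep _ _ m).
- by rewrite mx3_1.
- move=> h h'; rewrite /m mul_mx3.
  have -> : (h * h')%g.1 = (h.1 : F) + (h'.1 : F) by [].
  have -> : (h * h')%g.2 = (h.2 : F) + (h'.2 : F) by [].
  by congr mx3; ring.
- by move=> [x y] [x' y'] /mx3_inj[_ _ [/= -> -> _]].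
move=> g; split=> [/AutG_form_alg_mod_a3[x [y E]]|[h E]].
  by exists (x, y).
by apply/AutG_form_alg_mod_a3; exists h.1, h.2.
Qed.

End Form.

End FormAlgebras.

Section FormAlgebraGroups.
Variable F : fieldType.
Variables b11 b12 b21 b22 : F.
Hypothesis form_neq0 : [|| b11 != 0, b12 != 0, b21 != 0 | b22 != 0].
Notation mu := (form_alg b11 b12 b21 b22).

(** The group of similitudes, lifted so as to preserve the span of a_1 and a_2. *)
Definition form_complement : set (units 'M[F]_3) :=
  [set g | AutG mu g /\ exists a b c d e, uval g = mx3 a b 0 c d 0 0 0 e].

Lemma subgroup_form_complement : subgroup form_complement.
Proof.
have sA : subgroup (AutG mu) := subgroup_AutG _.
split; first by split; [case: sA|exists 1, 0, 0, 1, 1; exact: mx3_1].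
move=> g h [Ag [a [b [c [d [e Eg]]]]]] [Ah [a' [b' [c' [d' [e' Eh]]]]]].
have Agh : AutG mu (g / h)%g by apply: (proj2 sA).
split=> //; have : Aut mu (uval (g / h)%g) := Agh.
rewrite Aut_form_alg //.
move=> [p [q [r [s [x [y [f [Egh _ _ _]]]]]]]].
have Ah' := Ah; rewrite /AutG /= Aut_form_alg // Eh in Ah'.
case: Ah' => [? [? [? [? [? [? [? [/mx3_inj[[<- <- _] [<- <- _] _] [_ det0] _
  _]]]]]]]].
(* Comparing last rows in [g = (g / h) * h] gives a homogeneous system for the last row of [g / h],
   with the invertible block of [h] as matrix. Cramer's rule then yields zero. *)
have := etrans (esym Eg) (etrans (congr1 (@uval _) (esym (divgK h g)))
  (uval_mul Egh Eh)).
rewrite mulmx_mx3 => /mx3_inj[_ _ [/esym + /esym + _]].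
rewrite !(mulr0, addr0) => E1 E2.
exists p, q, r, s, f; rewrite Egh; congr mx3.
  apply: (mulr_eq0_l det0).
  transitivity ((x * a' + y * c') * d' - (x * b' + y * d') * c'); first by ring.
  by rewrite E1 E2; ring.
apply: (mulr_eq0_l det0).
transitivity ((x * b' + y * d') * a' - (x * a' + y * c') * b'); first by ring.
by rewrite E1 E2; ring.
Qed.

Lemma semidirect_form_alg : semidirect (AutG mu) (AutG_mod_a3 mu)
  form_complement.
Proof.
have sA : subgroup (AutG mu) := subgroup_AutG _.
have sN := isog_subgroup (isog_AutG_form_alg_mod_a3 form_neq0).
apply: semidirectI => //.
- exact: subgroup_form_complement.
- by move=> g [].
- by move=> g [].
- move=> k n [Ak [a [b [c [d [e Ek]]]]]] [An En]; split.
    by apply: (proj2 sA) => //; exact: subgroupM.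
  move=> x; have [r Er] := En (uval (k^-1)%g *m x); exists (e * r).
  have -> : uval (k * n / k)%g *m x - x
      = uval k *m (uval n *m (uval (k^-1)%g *m x) - uval (k^-1)%g *m x).
    rewrite mulmxBr !mulmxA -[uval k *m uval (k^-1)%g]/(uval (k / k)%g).
    by rewrite mulgV mul1mx.
  by rewrite Er Ek; col3_simp; congr col3; ring.
- move=> g /(AutG_form_alg_mod_a3 form_neq0)[x [y Eg]] [_ [a [b [c [d [e]]]]]].
  rewrite Eg => /mx3_inj[_ _ [x0 y0 _]].
  by apply: uval_eq1; rewrite Eg x0 y0 -mx3_1.
move=> g Ag; have := Ag; rewrite /AutG /= Aut_form_alg //.
move=> [a [b [c [d [x [y [e [Eg [e0 det0] [E1 E2] [E3 E4]]]]]]]]].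
have uk : mx3 a b 0 c d 0 0 0 e \in unitmx.
  rewrite unit_mx3; move: (mulf_neq0 e0 det0); congr (_ != _); ring.
pose k := unit_of (mx3 a b 0 c d 0 0 0 e).
have Ek : uval k = mx3 a b 0 c d 0 0 0 e by rewrite val_unit_of.
have Kk : form_complement k.
  split; last by exists a, b, c, d, e.
  by rewrite /AutG /= Aut_form_alg // Ek; exists a, b, c, d, 0, 0, e.
exists (g / k)%g, k; split; rewrite ?divgK //.
apply/(AutG_form_alg_mod_a3 form_neq0).
(* The row below, multiplied by the block of [k], gives [x, y]. *)
pose D := a * d - b * c.
exists ((x * d - y * c) / D), ((y * a - x * b) / D).
apply: uval_div; rewrite Eg Ek mulmx_mx3.
by congr mx3; rewrite /D; field.
Qed.

Lemma isog_form_complement (H : groupType) (m : H -> 'M[F]_3) :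
  m 1%g = 1 -> (forall x y, m (x * y)%g = m x * m y) -> injective m ->
  (forall h, exists a b c d e, m h = mx3 a b 0 c d 0 0 0 e) ->
  (forall h, Aut mu (m h)) ->
  (forall a b c d e, Aut mu (mx3 a b 0 c d 0 0 0 e) ->
     exists h, m h = mx3 a b 0 c d 0 0 0 e) ->
  isog form_complement H.
Proof.
move=> m1 mM m_inj mE mA Am; apply: (isog_rep m1 mM m_inj) => g; split.
  move=> [Ag [a [b [c [d [e Eg]]]]]]; have [|h Eh] := Am a b c d e.
    by rewrite -Eg.
  by exists h; rewrite Eg Eh.
by move=> [h Eg]; split; rewrite /AutG /= Eg //; exact: mE.
Qed.

End FormAlgebraGroups.

(** * Automorphisms of L_1, L_2, L_4, L_5 and L_6 *)

Section Nilpotent.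
Variable F : fieldType.

Lemma units_neq0 (u : units F) : uval u != 0.
Proof. by rewrite -unitfE (uvalP u). Qed.

Lemma unitsP (x : F) : x != 0 -> exists u : units F, uval u = x.
Proof. by rewrite -unitfE => ux; exists (Units ux). Qed.

Lemma units_inj : injective (@uval F).
Proof. exact: val_inj. Qed.

Lemma L1E : L1 = form_alg (1 : F) 0 0 0.
Proof.
by apply: eq_product => -[[|[|[|//]]] Hi] -[[|[|[|//]]] Hj] //=;
  rewrite ?scale1r ?scale0r.
Qed.

Lemma L2E : L2 = form_alg (1 : F) 1 0 0.
Proof.
by apply: eq_product => -[[|[|[|//]]] Hi] -[[|[|[|//]]] Hj] //=;
  rewrite ?scale1r ?scale0r.
Qed.

Lemma L3E (alpha : F) : L3 alpha = form_alg 1 alpha 1 0.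
Proof.
by apply: eq_product => -[[|[|[|//]]] Hi] -[[|[|[|//]]] Hj] //=;
  rewrite ?scale1r ?scale0r.
Qed.

Lemma L4E : L4 = form_alg (1 : F) (-1) 1 0.
Proof.
by apply: eq_product => -[[|[|[|//]]] Hi] -[[|[|[|//]]] Hj] //=;
  rewrite ?scaleN1r ?scale1r ?scale0r.
Qed.

Lemma L5E (beta : F) : L5 beta = form_alg 1 0 0 beta.
Proof.
by apply: eq_product => -[[|[|[|//]]] Hi] -[[|[|[|//]]] Hj] //=;
  rewrite ?scale1r ?scale0r.
Qed.

Lemma L6E (delta : F) : L6 delta = form_alg 1 1 0 delta.
Proof.
by apply: eq_product => -[[|[|[|//]]] Hi] -[[|[|[|//]]] Hj] //=;
  rewrite ?scale1r ?scale0r.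
Qed.

Lemma form_neq0_1 (b12 b21 b22 : F) :
  [|| (1 : F) != 0, b12 != 0, b21 != 0 | b22 != 0].
Proof. by rewrite oner_neq0. Qed.

Lemma Aut_L1 : Aut (@L1 F) = [set M | exists a b c d e : F,
    [/\ a != 0, d != 0 &
     M = mx3 a 0 0
             b d 0
             c e (a ^+ 2)]].
Proof.
rewrite L1E Aut_form_alg ?form_neq0_1 //; apply/seteqP; split=> M.
  move=> [a [b [c [d [x [y [e [-> [e0 det0] [E1 E2] [E3 E4]]]]]]]]].
  move: E1 E2 det0; scalar_simp => E1 E2.
  have a0 : a != 0 by apply: contraNneq e0 => a0; rewrite -E1 a0 mul0r.
  have -> : b = 0 by apply: (mulr_eq0_l a0); rewrite mulrC.
  scalar_simp => /mulf_neq0P[_ d0].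
  by exists a, c, x, d, y; rewrite expr2 E1.
move=> [a [b [c [d [e [a0 d0 ->]]]]]].
exists a, 0, b, d, c, e, (a ^+ 2); split=> //.
- by rewrite expf_neq0 // mul0r subr0 mulf_neq0.
- by split; ring.
by split; ring.
Qed.

Lemma Aut_L2 : Aut (@L2 F) = [set M | exists a b c d : F,
    a * (a + b) != 0 /\
    M = mx3 a 0       0
            b (a + b) 0
            c d       (a * (a + b))].
Proof.
rewrite L2E Aut_form_alg ?form_neq0_1 //; apply/seteqP; split=> M.
  move=> [a [b [c [d [x [y [e [-> [e0 det0] [E1 E2] [E3 E4]]]]]]]]].
  move: E1 E2 E3 E4 det0; scalar_simp => E1 E2 E3 E4.
  have /mulf_neq0P[a0 ac0] : a * (a + c) != 0 by rewrite mulrDr E1.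
  have b0 : b = 0 by apply: (mulr_eq0_l ac0); rewrite mulrDr.
  have -> : d = a + c.
    by apply: (mulfI a0); rewrite mulrDr E1 -E2 b0; ring.
  by exists a, c, x, y; rewrite b0 mulf_neq0 // mulrDr E1.
move=> [a [b [c [d [/mulf_neq0P[a0 ab0] ->]]]]].
exists a, 0, b, (a + b), c, d, (a * (a + b)); split=> //.
- by rewrite mul0r subr0 mulf_neq0.
- by split; ring.
by split; ring.
Qed.

Lemma Aut_L4 : Aut (@L4 F) = [set M | exists alpha1 alpha2 alpha3 beta3 : F,
     alpha1 != 0 /\
     M = mx3 alpha1 0      0
             alpha2 alpha1 0
             alpha3 beta3  (alpha1 ^+ 2)].
Proof.
rewrite L4E Aut_form_alg ?form_neq0_1 //; apply/seteqP; split=> M.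
  move=> [a [b [c [d [x [y [e [-> [e0 det0] [E1 E2] [E3 E4]]]]]]]]].
  move: E1 E2 E3 E4 det0; scalar_simp => E1 E2 E3 E4.
  have {}E1 : a * a = e by rewrite -E1; ring.
  have a0 : a != 0 by apply: contraNneq e0 => a0; rewrite -E1 a0 mul0r.
  (* In L_4 the mixed products cancel in [x, x], leaving the square of the a_1-coordinate of x; and
     a_2 has square zero. *)
  have /eqP : b * b = 0 by rewrite -[RHS]E4; ring.
  rewrite mulf_eq0 orbb => /eqP b0.
  have -> : d = a.
    by apply: (mulfI a0); rewrite E1 -E3 b0; ring.
  by exists a, c, x, y; rewrite b0 expr2 E1.
move=> [a [b [c [d [a0 ->]]]]].
exists a, 0, b, a, c, d, (a ^+ 2); split=> //.
- by rewrite expf_neq0 // mul0r subr0 mulf_neq0.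
- by split; ring.
by split; ring.
Qed.

Lemma L4_group : exists N K,
     [/\ semidirect (AutG (@L4 F)) N K,
         isog N (additive_group F * additive_group F)%type &
         isog K (additive_group F * units F)%type].
Proof.
exists (AutG_mod_a3 (@L4 F)), (form_complement (1 : F) (-1) 1 0).
rewrite L4E; split.
- exact/semidirect_form_alg/form_neq0_1.
- exact/isog_AutG_form_alg_mod_a3/form_neq0_1.
(* The block is the scalar [u] times a unipotent matrix with entry [b]. These factors commute, which
   explains the entry [u * b] and gives a direct product. *)
pose m (h : additive_group F * units F) : 'M[F]_3 :=
  mx3 (uval h.2) 0 0 (uval h.2 * (h.1 : F)) (uval h.2) 0 0 0 (uval h.2 ^+ 2).
apply: (@isog_form_complement _ _ _ _ _ _ m).
- by rewrite /m mx3_1 /= mulr0 expr1n.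
- move=> h h'; rewrite /m mul_mx3.
  have -> : (h * h')%g.1 = (h.1 : F) + (h'.1 : F) by [].
  have -> : uval (h * h')%g.2 = uval h.2 * uval h'.2 by [].
  by congr mx3; ring.
- move=> [b u] [b' u'] /mx3_inj[[/= /units_inj -> _ _] [/= E _ _] _].
  by congr (_, _); apply: (mulfI (units_neq0 u')).
- by move=> h; do 5!eexists.
- move=> h; rewrite -L4E Aut_L4; do 4!eexists; split; last by [].
  exact: units_neq0.
move=> a b c d e; rewrite -L4E Aut_L4.
move=> [a' [c' [_ [_ [a0 /mx3_inj[[-> -> _] [-> -> _] [_ _ ->]]]]]]].
have [u Eu] := unitsP a0.
exists (a'^-1 * c' : F, u); rewrite /m /= Eu; congr mx3.
by rewrite mulrA mulfV // mul1r.
Qed.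

Lemma anisotropic5 (beta x y : F) : L5_param beta ->
  x ^+ 2 + beta * y ^+ 2 = 0 ->
  x = 0 /\ y = 0.
Proof.
move=> nr E; have y0 : y = 0.
  apply/eqP/negPn/negP => y0; have /negP[] := nr (x / y).
  rewrite rootE !hornerE expr_div_n -(mulfK (expf_neq0 2 y0) beta) -mulrDl.
  by rewrite E mul0r.
by move: E; rewrite y0 expr0n mulr0 addr0 => /eqP; rewrite sqrf_eq0 => /eqP.
Qed.

Lemma anisotropic6 (delta x y : F) : L6_param delta ->
  x ^+ 2 + x * y + delta * y ^+ 2 = 0 -> x = 0 /\ y = 0.
Proof.
move=> nr E; have y0 : y = 0.
  apply/eqP/negPn/negP => y0; have /negP[] := nr (x / y).
  rewrite rootE !hornerE; apply/eqP; rewrite -[RHS](mul0r (y ^- 2)) -E.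
  by field.
by move: E; rewrite y0 expr0n !mulr0 !addr0 => /eqP; rewrite sqrf_eq0 => /eqP.
Qed.

Lemma pair_neq0 (x y : F) : ((x, y) != (0, 0)) = (x != 0) || (y != 0).
Proof. by rewrite xpair_eqE negb_and. Qed.

Lemma Aut_L5 (beta : F) : L5_param beta ->
    Aut (L5 beta) = [set M | exists a b c d eps : F,
      [/\ (a, b) != (0, 0), eps ^+ 2 = 1 &
       M = mx3 a (- (eps * beta * b)) 0
               b (eps * a)            0
               c d                    (a ^+ 2 + beta * b ^+ 2)]].
Proof.
move=> nr; rewrite L5E Aut_form_alg ?form_neq0_1 //; apply/seteqP; split=> M.
  move=> [a [b [c [d [x [y [e [-> [e0 det0] [E1 E2] [E3 E4]]]]]]]]].
  move: E1 E2 E3 E4 det0; scalar_simp => E1 E2 E3 E4 _.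
  have beta0 : beta != 0.
    by have := nr 0; rewrite rootE !hornerE expr0n add0r.
  (* For the block P and B = diag(1, beta), P^T B P = e B gives (det P) B P = e adj(P)^T B. The
     first column of this is [Ed] and [Eb]. *)
  have Eb : b * e = - ((a * d - b * c) * beta * c).
    by rewrite -E1; apply: subr0_eq; rewrite -[RHS](mul0r a) -E2; ring.
  have Ed : d * e = (a * d - b * c) * a.
    by rewrite -E1; apply: subr0_eq; rewrite -[RHS](mul0r c) -E2; ring.
  (* eps is the determinant of the induced similitude over its multiplier. *)
  exists a, c, x, y, ((a * d - b * c) / e).
  have -> : (a * d - b * c) / e * a = d.
    by apply: (mulIf e0); rewrite Ed; field.
  have Eb' : - ((a * d - b * c) / e * beta * c) = b.
    by apply: (mulIf e0); rewrite Eb; field.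
  split.
  - rewrite pair_neq0 -negb_and; apply: contraNN e0 => /andP[/eqP a0 /eqP c0].
    by rewrite -E1 a0 c0 !mulr0 addr0.
  (* Determinants of P^T B P = e B, by way of (a^2 + beta c^2)(b^2 + beta d^2) = (a b + beta c d)^2
     + beta (a d - b c)^2. *)
  - have e2 : e ^+ 2 * beta = (a * d - b * c) ^+ 2 * beta.
      have -> : e ^+ 2 * beta = e * (e * beta) by ring.
      rewrite -E4 -E1; apply: subr0_eq.
      transitivity ((a * b + beta * c * d) ^+ 2); first by ring.
      by rewrite E2 expr0n.
    by rewrite expr_div_n -(mulIf beta0 e2) mulfV // expf_neq0.
  - by rewrite Eb' -E1; congr mx3; ring.
move=> [a [b [c [d [eps [ab0 eps1 ->]]]]]].
have e0 : a ^+ 2 + beta * b ^+ 2 != 0.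
  apply: contraNneq ab0 => /(anisotropic5 nr)[-> ->]; exact: eqxx.
have eps0 : eps != 0 by rewrite -(sqrf_eq0 eps) eps1 oner_neq0.
exists a, (- (eps * beta * b)), b, (eps * a), c, d, (a ^+ 2 + beta * b ^+ 2).
split=> //.
- split=> //; move: (mulf_neq0 eps0 e0); congr (_ != _); ring.
- by split; ring.
split; first by ring.
transitivity (eps ^+ 2 * (a ^+ 2 + beta * b ^+ 2) * beta); first by ring.
by rewrite eps1 mul1r.
Qed.

Lemma Aut_L6 (delta : F) : L6_param delta ->
    Aut (L6 delta) = [set M | exists alpha1 alpha2 alpha3 beta3 : F,
      (alpha1, alpha2) != (0, 0) /\
      M = mx3 alpha1 (- (delta * alpha2)) 0
              alpha2 (alpha1 + alpha2)    0
              alpha3 beta3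
                (alpha1 ^+ 2 + alpha1 * alpha2 + delta * alpha2 ^+ 2)].
Proof.
move=> nr; rewrite L6E Aut_form_alg ?form_neq0_1 //; apply/seteqP; split=> M.
  move=> [a [b [c [d [x [y [e [-> [e0 det0] [E1 E2] [E3 E4]]]]]]]]].
  move: E1 E2 E3 E4 det0; scalar_simp => E1 E2 E3 E4 _.
  exists a, c, x, y.
  (* The alternating part B - B^T is multiplied by det P on one side and by [e] on the other; for
     L_6 it is not zero. *)
  have Ee : a * d - b * c = e.
    by rewrite -E2 -[RHS]subr0 -E3; ring.
  have Ed : d = a + c.
    apply: (mulIf e0); transitivity ((a + c) * (a * d - b * c));
      last by rewrite Ee.
    by rewrite -E1; apply: subr0_eq; rewrite -[RHS](mul0r c) -E3; ring.
  have Eb : b = - (delta * c).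
    apply: (mulIf e0); transitivity (- (delta * c) * (a * d - b * c));
      last by rewrite Ee.
    by rewrite -E1; apply: subr0_eq; rewrite -[RHS](mul0r a) -E3; ring.
  split; last by rewrite -Ed -Eb -E1; congr mx3; ring.
  rewrite pair_neq0 -negb_and; apply: contraNN e0 => /andP[/eqP a0 /eqP c0].
  by rewrite -E1 a0 c0 !mulr0 !addr0.
move=> [a [b [c [d [ab0 ->]]]]].
have e0 : a ^+ 2 + a * b + delta * b ^+ 2 != 0.
  apply: contraNneq ab0 => /(anisotropic6 nr)[-> ->]; exact: eqxx.
exists a, (- (delta * b)), b, (a + b), c, d.
exists (a ^+ 2 + a * b + delta * b ^+ 2); split=> //.
- split=> //; move: e0; congr (_ != _); ring.
- by split; ring.
by split; ring.
Qed.

End Nilpotent.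

(** * Products of two represented groups, and extensions by an involution *)

Section RepProducts.
Variables (F : fieldType) (t : nat -> nat -> 'cV[F]_3).
Variables (H1 H2 : groupType) (m1 : H1 -> 'M[F]_3) (m2 : H2 -> 'M[F]_3).
Hypotheses (m11 : m1 1%g = 1) (m1M : forall x y, m1 (x * y)%g = m1 x * m1 y).
Hypotheses (m21 : m2 1%g = 1) (m2M : forall x y, m2 (x * y)%g = m2 x * m2 y).
Hypotheses (m1_inj : injective m1) (m2_inj : injective m2).
Hypothesis m12 : forall h k, m1 h = m2 k -> m1 h = 1.
Hypothesis AutE : forall M, Aut (product t) M <-> exists h k, M = m1 h *m m2 k.

Let phi h := unit_of (m1 h).
Let psi k := unit_of (m2 k).
Let N : set (units 'M[F]_3) := [set g | exists h, uval g = m1 h].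
Let K : set (units 'M[F]_3) := [set g | exists k, uval g = m2 k].

Let phiE h : uval (phi h) = m1 h := uval_rep m11 m1M h.
Let psiE k : uval (psi k) = m2 k := uval_rep m21 m2M k.

Let isoN : isomorphism phi N. Proof. exact: isomorphism_rep. Qed.
Let isoK : isomorphism psi K. Proof. exact: isomorphism_rep. Qed.

Let NA : N `<=` AutG (product t).
Proof. by move=> g [h E]; apply/AutE; exists h, 1%g; rewrite E m21 mulmx1. Qed.

Let KA : K `<=` AutG (product t).
Proof. by move=> g [k E]; apply/AutE; exists 1%g, k; rewrite E m11 mul1mx. Qed.

Let NK1 g : N g -> K g -> g = 1%g.
Proof.
by move=> [h Eh] [k Ek]; apply: uval_eq1; rewrite Eh; apply: (m12 (k := k));
  rewrite -Eh.
Qed.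

Let AutNK g : AutG (product t) g -> exists n k, [/\ N n, K k & g = (n * k)%g].
Proof.
move=> /AutE[h [k E]]; exists (phi h), (psi k); split.
- by exists h.
- by exists k.
- by apply: uval_inj; rewrite (uval_mul (phiE h) (psiE k)).
Qed.

(** The maps [phi] and [psi] stay in the conclusion because the action of the complement has to be
    explicit for L_8. *)
Lemma semidirect_rep (act : H2 -> H1 -> H1) :
  (forall k h, m2 k *m m1 h = m1 (act k h) *m m2 k) ->
  exists N K (phi : H1 -> units 'M[F]_3) (psi : H2 -> units 'M[F]_3),
    [/\ semidirect (AutG (product t)) N K, isomorphism phi N,
      isomorphism psi K &
        forall k h, (psi k * phi h / psi k)%g = phi (act k h)].
Proof.
move=> actE; exists N, K, phi, psi.
have conj k h : (psi k * phi h / psi k)%g = phi (act k h).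
  apply: uval_inj; apply: uval_div.
  by rewrite (uval_mul (psiE k) (phiE h)) phiE psiE.
split=> //; apply: semidirectI => //.
- exact: subgroup_AutG.
- exact: subgroup_range isoN.
- exact: subgroup_range isoK.
move=> k n [k' Ek] [h En]; exists (act k' h).
have -> : k = psi k' by apply: uval_inj; rewrite psiE.
have -> : n = phi h by apply: uval_inj; rewrite phiE.
by rewrite conj phiE.
Qed.

Lemma direct_rep : (forall k h, m2 k *m m1 h = m1 h *m m2 k) ->
  exists P Q, [/\ direct (AutG (product t)) P Q, isog P H1 & isog Q H2].
Proof.
move=> m12C; exists N, K; split; [|by exists phi|by exists psi].
apply: directI => //.
- exact: subgroup_AutG.
- exact: subgroup_range isoN.
- exact: subgroup_range isoK.
move=> k n [k' Ek] [h En]; apply: uval_inj.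
by rewrite (uval_mul Ek En) (uval_mul En Ek).
Qed.

End RepProducts.

(** This covers the extra automorphisms of L_3(1), L_14(-1) and L_16(beta, 0): the represented group
    has index two, and an involution [S] outside it generates a complement. *)
Lemma semidirect_involution (F : fieldType) (A : set (units 'M[F]_3))
    (H : groupType) (m : H -> 'M[F]_3) (S : 'M[F]_3) (act : H -> H) :
  m 1%g = 1 -> (forall x y, m (x * y)%g = m x * m y) -> injective m ->
  subgroup A -> S *m S = 1 -> (forall h, S <> m h) ->
  (forall h, S *m m h = m (act h) *m S) ->
  (forall g, A g <-> (exists h, uval g = m h) \/ (exists h,
    uval g = m h *m S)) ->
  exists N K (phi : H -> units 'M[F]_3),
    [/\ semidirect A N K, isomorphism phi N, order_two K &
        forall s, K s -> s <> 1%g -> forall h, (s * phi h / s)%g = phi (act h)].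
Proof.
move=> m1 mM m_inj sA SS Sm actE AE.
pose N : set (units 'M[F]_3) := [set g | exists h, uval g = m h].
pose phi h := unit_of (m h).
have phiE h : uval (phi h) = m h := uval_rep m1 mM h.
have isoN : isomorphism phi N by exact: isomorphism_rep.
pose s := unit_of S.
have Es : uval s = S by apply: val_unit_of; have [] := mulmx1_unit SS.
have ss : (s * s = 1)%g by apply: uval_eq1; rewrite (uval_mul Es Es).
have s1 : s <> 1%g by move=> s1; apply: (Sm 1%g); rewrite -Es s1 m1.
have conj h : (s * phi h / s)%g = phi (act h).
  apply: uval_inj; apply: uval_div.
  by rewrite (uval_mul Es (phiE h)) phiE Es.
exists N, [set 1%g; s], phi; split=> //; first last.
- by move=> _ [->|->].
- exact: order_twoI.
apply: semidirectI => //.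
- exact: subgroup_range isoN.
- by case: (order_twoI ss s1).
- by move=> g [h Eg]; apply/AE; left; exists h.
- move=> _ [->|->]; first by case: sA.
  by apply/AE; right; exists 1%g; rewrite Es m1 mul1mx.
- move=> _ n [->|->] [h En]; first by exists h; rewrite mul1g invg1 mulg1.
  have -> : n = phi h by apply: uval_inj; rewrite phiE.
  by rewrite conj; exists (act h).
- by move=> g [h Eg] [//|E]; case: (Sm h); rewrite -Es -E.
move=> g /AE[[h Eg]|[h Eg]].
  by exists g, 1%g; rewrite mulg1; split=> //; [exists h|left].
exists (phi h), s; split; [by exists h|by right|].
by apply: uval_inj; rewrite (uval_mul (phiE h) Es).
Qed.

(** * Automorphisms of L_3 *)

Section L3Automorphisms.
Variable F : fieldType.
Variable alpha : F.
Hypotheses (alpha0 : alpha != 0) (alphaN1 : alpha != -1).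

Let S : set 'M[F]_3 := [set M | exists alpha1 beta2 alpha3 beta3 : F,
  [/\ alpha1 != 0, beta2 != 0 &
   M = mx3 alpha1                              0     0
           ((beta2 - alpha1) / (1 + alpha))    beta2 0
           alpha3                              beta3 (alpha1 * beta2)]].

Let S' : set 'M[F]_3 := [set M | exists alpha1 alpha2 alpha3 beta3 : F,
  alpha1 * (alpha1 + 2%:R * alpha2) != 0 /\
  M = mx3 alpha1 (2%:R * alpha1) 0
          alpha2 (- alpha1)      0
          alpha3 beta3           (alpha1 * (alpha1 + 2%:R * alpha2))].

Lemma addr1_alpha_neq0 : 1 + alpha != 0.
Proof. by rewrite addrC addr_eq0. Qed.

(** The quadratic form x_1^2 + (1 + alpha) x_1 x_2 has two isotropic lines, which an automorphism
    fixes or interchanges. On an isotropic basis the two mixed products have ratio alpha; an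
    interchange inverts it, so alpha^2 = 1, and alpha = -1 is excluded. *)
Lemma Aut_L3_cases M : Aut (L3 alpha) M -> S M \/ alpha = 1 /\ S' M.
Proof.
have u0 := addr1_alpha_neq0.
rewrite L3E Aut_form_alg ?form_neq0_1 //.
move=> [a [b [c [d [x [y [e [-> [e0 det0] [E1 E2] [E3 E4]]]]]]]]].
move: E1 E2 E3 E4; scalar_simp => E1 E2 E3 E4.
have Ee : a * (a + (1 + alpha) * c) = e by rewrite -E1; ring.
have /mulf_neq0P[a0 ac0] : a * (a + (1 + alpha) * c) != 0 by rewrite Ee.
have /eqP : b * (b + (1 + alpha) * d) = 0 by rewrite -[RHS]E4; ring.
(* Here [b = 0] means that the isotropic line of a_2 is fixed. *)
rewrite mulf_eq0; have [b0 _|b0 /= /eqP Eb] := eqVneq b 0.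
  left; rewrite b0 in E2 E3 E4 *.
  have Ead : a * d = e by rewrite -E3; ring.
  have d0 : d != 0 by apply: contraNneq e0 => d0; rewrite -Ead d0 mulr0.
  exists a, d, x, y; split=> //; rewrite Ead; congr mx3.
  have -> : d = a + (1 + alpha) * c by apply: (mulfI a0); rewrite Ead.
  by field.
right.
have alpha1 : alpha = 1.
  apply/esym/subr0_eq/(mulr_eq0_l (mulf_neq0 b0 ac0)).
  transitivity (a * b + alpha * a * d + c * b - alpha * (b * a + alpha * b * c
    + d * a)).
    by ring.
  by rewrite E2 E3; ring.
split=> //.
have {}Eb : b = - (2%:R * d).
  by apply/eqP; rewrite -addr_eq0; apply/eqP; rewrite -[RHS]Eb alpha1; ring.
have Eda : d = - a.
  apply: (mulIf ac0).
  transitivity (- (b * a + alpha * b * c + d * a)).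
    by rewrite Eb alpha1; ring.
  by rewrite E3 -Ee; ring.
exists a, c, x, y; rewrite Eb Eda -Ee alpha1; split.
  by move: (mulf_neq0 a0 ac0); rewrite alpha1.
by congr mx3; ring.
Qed.

Lemma Aut_L3_triangular M : S M -> Aut (L3 alpha) M.
Proof.
have u0 := addr1_alpha_neq0.
move=> [a [b [x [y [a0 b0 ->]]]]]; rewrite L3E Aut_form_alg ?form_neq0_1 //.
exists a, 0, ((b - a) / (1 + alpha)), b, x, y, (a * b).
split=> //; first by rewrite mul0r subr0 mulf_neq0.
  by split; [field|ring].
by split; ring.
Qed.

Lemma Aut_L3_swap M : alpha = 1 -> S' M -> Aut (L3 alpha) M.
Proof.
move=> alpha1 [a [c [x [y [ac0 ->]]]]];
  rewrite L3E Aut_form_alg ?form_neq0_1 //.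
exists a, (2%:R * a), c, (- a), x, y, (a * (a + 2%:R * c)).
split=> //; rewrite ?alpha1.
- by split=> //; move: ac0; rewrite -oppr_eq0; congr (_ != _); ring.
- by split; ring.
by split; ring.
Qed.

(** On the span of a_1 and a_2 this is the diagonal torus for the isotropic vectors a_1 - a_2 / (1 +
    alpha) and a_2. *)
Definition L3_torus (h : units F * units F) : 'M[F]_3 :=
  mx3 (uval h.1) 0 0
      ((uval h.2 - uval h.1) / (1 + alpha)) (uval h.2) 0
      0 0 (uval h.1 * uval h.2).

Lemma L3_torus1 : L3_torus 1%g = 1.
Proof. by rewrite /L3_torus mx3_1 /= subrr mul0r mulr1. Qed.

Lemma L3_torusM h h' : L3_torus (h * h')%g = L3_torus h * L3_torus h'.
Proof.
have u0 := addr1_alpha_neq0.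
rewrite /L3_torus mul_mx3.
have -> : uval (h * h')%g.1 = uval h.1 * uval h'.1 by [].
have -> : uval (h * h')%g.2 = uval h.2 * uval h'.2 by [].
by congr mx3; field.
Qed.

Lemma L3_torus_inj : injective L3_torus.
Proof.
by move=> [u v] [u' v'] /mx3_inj[[/= /units_inj -> _ _] [_ /units_inj -> _] _].
Qed.

Lemma L3_torus_triangular h : S (L3_torus h).
Proof.
exists (uval h.1), (uval h.2), 0, 0; split=> //; exact: units_neq0.
Qed.

Lemma triangular_torus a b c d e : S (mx3 a b 0 c d 0 0 0 e) ->
  exists h, mx3 a b 0 c d 0 0 0 e = L3_torus h.
Proof.
move=> [p [q [x [y [/unitsP[u Eu] /unitsP[v Ev]]]]]].
move=> /mx3_inj[[-> -> _] [-> -> _] [_ _ ->]].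
by exists (u, v); rewrite /L3_torus /= Eu Ev.
Qed.

Notation K := (form_complement 1 alpha 1 0).

Lemma isog_L3_complement : alpha != 1 -> isog K (units F * units F)%type.
Proof.
move=> alpha1; apply: (isog_form_complement L3_torus1 L3_torusM L3_torus_inj).
- by move=> h; do 5!eexists.
- by move=> h; rewrite -L3E; exact/Aut_L3_triangular/L3_torus_triangular.
move=> a b c d e; rewrite -L3E => /Aut_L3_cases[/triangular_torus[h ->]|[]].
  by exists h.
by move=> /eqP; rewrite (negPf alpha1).
Qed.

Lemma L3_complement_split : alpha = 1 -> exists N H,
  [/\ semidirect K N H, isog N (units F * units F)%type & order_two H].
Proof.
move=> alpha1; have u0 := addr1_alpha_neq0.
have two0 : 2%:R != 0 :> F by move: u0; rewrite alpha1.
(* This involution interchanges the isotropic vectors a_2 and 2 a_1 - a_2. *)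
pose M : 'M[F]_3 := mx3 1 2%:R 0 0 (-1) 0 0 0 1.
have MM : M *m M = 1 by rewrite mulmx_mx3 mx3_1; congr mx3; ring.
have MN h : M <> L3_torus h.
  by move=> /mx3_inj[[_ E _] _ _]; move/eqP: two0; rewrite E.
have actM h : M *m L3_torus h = L3_torus (h.2, h.1) *m M.
  by rewrite !mulmx_mx3 alpha1 /=; congr mx3; field.
have [|N [H [phi [semi iso ord _]]]] := semidirect_involution L3_torus1
  L3_torusM
  L3_torus_inj (subgroup_form_complement (form_neq0_1 alpha 1 0)) MM MN actM;
  last by exists N, H; split=> //; exists phi.
move=> g; split.
  move=> [Ag [a [b [c [d [e Eg]]]]]].
  have := Ag; rewrite /AutG /= -L3E => /Aut_L3_cases; rewrite Eg.
  case=> [/triangular_torus|[_ [p [q [x [y [/mulf_neq0P[p0 q0]]]]]]]];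
    first by left.
  move=> /mx3_inj[[-> -> _] [-> -> _] [_ _ ->]]; right.
  have [u Eu] := unitsP p0; have [v Ev] := unitsP q0.
  exists (u, v); rewrite mulmx_mx3 /= Eu Ev.
  by rewrite alpha1; congr mx3; field.
move=> [[h Eg]|[h Eg]]; split.
- by rewrite /AutG /= Eg -L3E; exact/Aut_L3_triangular/L3_torus_triangular.
- by rewrite Eg; do 5!eexists.
- rewrite /AutG /= Eg -L3E; apply: (Aut_L3_swap alpha1).
  exists (uval h.1), ((uval h.2 - uval h.1) / 2%:R), 0, 0.
  split; last by rewrite mulmx_mx3 alpha1; congr mx3; field.
  have -> : uval h.1 * (uval h.1 + 2%:R * ((uval h.2 - uval h.1) / 2%:R))
    = uval h.1 * uval h.2 by field.
  by rewrite mulf_neq0 ?units_neq0.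
rewrite Eg mulmx_mx3; do 5!eexists.
by congr mx3; ring.
Qed.

Lemma L3_automorphisms :
  [/\ alpha != 1 -> Aut (L3 alpha) = S,
      alpha = 1 -> Aut (L3 alpha) = S `|` S',
      isog (AutG_mod_a3 (L3 alpha)) (additive_group F * additive_group F)%type &
      exists K, [/\
        semidirect (AutG (L3 alpha)) (AutG_mod_a3 (L3 alpha)) K,
        alpha != 1 -> isog K (units F * units F)%type &
        alpha = 1 -> exists N H,
          [/\ semidirect K N H, isog N (units F * units F)%type &
              order_two H]]].
Proof.
split.
- move=> alpha1; apply/seteqP; split=> M; last exact: Aut_L3_triangular.
  by move=> /Aut_L3_cases[//|[/eqP]]; rewrite (negPf alpha1).
- move=> alpha1; apply/seteqP; split=> M.
    by move=> /Aut_L3_cases[|[_]]; [left|right].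
  by move=> [/Aut_L3_triangular|/(Aut_L3_swap alpha1)].
- by rewrite L3E; apply: isog_AutG_form_alg_mod_a3 (form_neq0_1 _ _ _).
exists K; rewrite L3E; split.
- exact: semidirect_form_alg (form_neq0_1 _ _ _).
- exact: isog_L3_complement.
- exact: L3_complement_split.
Qed.

End L3Automorphisms.

(** * Coordinates in a quadratic extension, for L_6 and L_16 *)

Section QuadraticExtension.
Variables (F : fieldType) (E : fieldExtType F) (theta : E) (beta gamma : F).
Hypothesis gen : <<1%VS; theta>>%VS = fullv.
Hypothesis theta2 : theta ^+ 2 = gamma *: theta + beta%:A.
Hypothesis no_root : forall x : F, x ^+ 2 - gamma * x - beta != 0.

Lemma quadratic_mul (a b a' b' : F) :
  (a%:A + b *: theta) * (a'%:A + b' *: theta) =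
  (a * a' + beta * (b * b'))%:A + (a * b' + b * a' + gamma * (b * b')) *: theta.
Proof.
(* Scalars are carried into [E], so that the identity becomes one for [ring]. *)
have ZE k x : k *: x = in_alg E k * x by rewrite mulr_algl.
have := theta2; rewrite !ZE => theta2E.
apply: subr0_eq; rewrite !(rmorphD, rmorphM).
transitivity (in_alg E b * in_alg E b' * (theta ^+ 2
  - (in_alg E gamma * theta + in_alg E beta * 1))); first by ring.
by rewrite theta2E subrr mulr0.
Qed.

Lemma quadratic_exists (u : E) : exists c : F * F, u = c.1%:A + c.2 *: theta.
Proof.
have thetaX n : exists c : F * F, theta ^+ n = c.1%:A + c.2 *: theta.
  elim: n => [|n [c IHn]].
    by exists (1, 0); rewrite expr0 scale1r scale0r addr0.
  exists (beta * c.2, c.1 + gamma * c.2); rewrite exprS IHn /=.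
  have := quadratic_mul 0 1 c.1 c.2.
  rewrite scale0r add0r scale1r => ->.
  by rewrite !mul1r !mul0r !add0r.
have : u \in <<1%VS; theta>>%VS by rewrite gen memvf.
move=> /Fadjoin_polyP[p /polyOverP p1 ->]; rewrite horner_coef.
elim/big_ind: _ => [|x y [c ->] [d ->]|i _].
- by exists (0, 0); rewrite !scale0r addr0.
- by exists (c.1 + d.1, c.2 + d.2); rewrite /= !scalerDl addrACA.
have /vlineP[k ->] := p1 i; have [c ->] := thetaX i.
by exists (k * c.1, k * c.2); rewrite mulr_algl scalerDr !scalerA.
Qed.

Lemma quadratic_free (a b : F) : a%:A + b *: theta = 0 -> a = 0 /\ b = 0.
Proof.
move=> ab0; have b0 : b = 0.
  apply/eqP/negPn/negP => b0.
  have Et : theta = (- (a / b))%:A.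
    apply: (scalerI b0); rewrite scalerA mulrN mulrCA mulfV // mulr1 scaleNr.
    by apply/eqP; rewrite -addr_eq0 addrC ab0.
  set x := - (a / b) in Et; have /eqP[] := no_root x.
  apply: (fmorph_inj (in_alg E)); rewrite rmorph0 !rmorphB rmorphXn rmorphM /=.
  by rewrite -Et theta2 mulr_algl -addrA -opprD subrr.
split=> //; move/eqP: ab0; rewrite b0 scale0r addr0 scaler_eq0 oner_eq0 orbF.
by move/eqP.
Qed.

(** Existence of coordinates comes from reducing powers of theta, and uniqueness from the absence of
    roots in F. *)
Lemma quadratic_coords : exists co : E -> F * F,
  (forall u, u = (co u).1%:A + (co u).2 *: theta) /\
  (forall a b, co (a%:A + b *: theta) = (a, b)).
Proof.
have [co coE] := choice quadratic_exists; exists co; split=> // a b.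
have := coE (a%:A + b *: theta); case: (co _) => c d /= /eqP.
rewrite -subr_eq0 opprD addrACA -!scalerBl => /eqP/quadratic_free[].
by move=> /subr0_eq <- /subr0_eq <-.
Qed.

End QuadraticExtension.

Section L6Group.
Variables (F : fieldType) (delta : F).
Hypothesis delta_param : L6_param delta.

Lemma L6_group (E : fieldExtType F) (theta : E) :
  <<1%VS; theta>>%VS = fullv -> theta ^+ 2 - theta + delta%:A = 0 ->
  exists N K,
    [/\ semidirect (AutG (L6 delta)) N K,
        isog N (additive_group F * additive_group F)%type &
        isog K (units E)].
Proof.
move=> gen theta2.
have theta2' : theta ^+ 2 = 1 *: theta + (- delta)%:A.
  by rewrite scale1r scaleNr; apply/subr0_eq;
    rewrite -[RHS]theta2 opprB addrA addrAC.
have no_root (x : F) : x ^+ 2 - 1 * x - (- delta) != 0.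
  by have := delta_param (- x); rewrite rootE !hornerE sqrrN ?mul1r opprK.
have [co [coE coK]] := quadratic_coords gen theta2' no_root.
have coM u v : co (u * v) = ((co u).1 * (co v).1 - delta * ((co u).2 * (co
  v).2),
    (co u).1 * (co v).2 + (co u).2 * (co v).1 + (co u).2 * (co v).2).
  by rewrite {1}[u]coE {1}[v]coE (quadratic_mul theta2') coK mulNr mul1r.
have co1 : co 1 = (1, 0).
  by rewrite -[RHS]coK scale1r scale0r addr0.
have co_neq0 (u : units E) : co (uval u) != (0, 0).
  apply/eqP => E0; have := uvalP u; rewrite [uval u]coE E0 !scale0r addr0.
  by rewrite unitr0.
exists (AutG_mod_a3 (L6 delta)), (form_complement (1 : F) 1 0 delta).
rewrite L6E; split.
- exact: semidirect_form_alg (form_neq0_1 _ _ _).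
- exact: isog_AutG_form_alg_mod_a3 (form_neq0_1 _ _ _).
(* The block is multiplication by a + b theta in the basis 1, theta; the multiplier in the corner is
   the norm of a + b theta. *)
pose m (u : units E) : 'M[F]_3 := let: (a, b) := co (uval u) in
  mx3 a (- (delta * b)) 0 b (a + b) 0 0 0 (a ^+ 2 + a * b + delta * b ^+ 2).
apply: (@isog_form_complement _ _ _ _ _ _ m).
- by rewrite /m co1 mx3_1; congr mx3; ring.
- move=> u v; rewrite /m; have -> : uval (u * v)%g = uval u * uval v by [].
  rewrite coM; case: (co (uval u)) => a b; case: (co (uval v)) => c d /=.
  by rewrite mul_mx3; congr mx3; ring.
- move=> u v; rewrite /m => E12; apply: val_inj => /=.
  rewrite [LHS]coE [RHS]coE; move: E12.
  case: (co (uval u)) => a b; case: (co (uval v)) => c d /=.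
  by move=> /mx3_inj[[-> _ _] [-> _ _] _].
- by move=> u; rewrite /m; case: (co _) => a b; do 5!eexists.
- move=> u; rewrite /m -L6E Aut_L6 //; case: (co _) (co_neq0 u) => a b ab0.
  by exists a, b, 0, 0.
move=> a b c d e; rewrite -L6E Aut_L6 // => -[p [q [x [y [pq0]]]]].
move=> /mx3_inj[[-> -> _] [-> -> _] [_ _ ->]].
have : p%:A + q *: theta \is a GRing.unit.
  rewrite unitfE; apply: contraNneq pq0.
  by move=> /(quadratic_free theta2' no_root)[-> ->].
by move=> uu; exists (Units uu); rewrite /m /= coK.
Qed.

End L6Group.

(** * Automorphisms of L_7 to L_16 *)

Section NonNilpotent.
Variable F : fieldType.

Lemma mulr_fix (x y : F) : y != 0 -> y = x * y -> x = 1.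
Proof. by move=> y0 E; apply: (mulIf y0); rewrite -E mul1r. Qed.

Lemma Aut_L7 : Aut (@L7 F) = [set M | exists alpha2 beta2 alpha3 : F,
     beta2 != 0 /\
     M = mx3 1      0     0
             alpha2 beta2 0
             alpha3 0     1].
Proof.
apply/seteqP; split=> M.
  aut_intro M.
  move=> [[/col3_inj[E1 E2 E3] /col3_inj[E4 E5 E6] _] _ _].
  move: uM E2 E3 E5 E6; rewrite E1 E4; scalar_simp => uM E2 E3 E5 E6.
  have x22_0 : x22 != 0.
    by have /mulf_neq0P[_ /mulf_neq0P[]] : x11 * (x22 * x33) != 0;
      move: uM; rewrite E6 mulr0 subr0.
  have x11_1 := mulr_fix x22_0 E5.
  exists x21, x22, x31; split=> //; rewrite E2 E3 E6 x11_1; congr mx3; ring.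
move=> [a [b [c [b0 ->]]]]; aut_elim ltac:(ring); by [].
Qed.

Lemma Aut_L8 (lambda : F) : 2%N \in [pchar F] ->
  Aut (L8 lambda) = [set M | exists alpha2 beta2 alpha3 : F,
          [/\ beta2 != 0, alpha2 ^+ 2 = lambda * (beta2 ^+ 2 - 1) &
           M = mx3 1      0                0
                   alpha2 beta2            0
                   alpha3 (alpha2 * beta2) (beta2 ^+ 2)]].
Proof.
move=> ch2; apply/seteqP; split=> M.
  aut_intro M.
  move=> [[/col3_inj[E1 E2 E3] /col3_inj[E4 E5 E6] _] [_ /col3_inj[E7 E8 E9] _]
    _].
  move: uM E2 E3 E5 E6 E8 E9; rewrite E7 E4; scalar_simp =>
    uM E2 E3 E5 E6 E8 E9.
  move: uM; rewrite E8; scalar_simp => /mulf_neq0P[_ /mulf_neq0P[x22_0 _]].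
  have x11_1 := mulr_fix x22_0 E5.
  exists x21, x22, x31; split=> //; last by rewrite E6 E9 x11_1.
  transitivity (x22 * x22 * lambda - lambda); last by ring.
  by rewrite -E9 E3 x11_1; ring.
move=> [a [b [c [b0 ab ->]]]];
  aut_elim ltac:(rewrite ?(addrr_pchar2 ch2) -?expr2 ?ab; ring).
  by rewrite mulf_neq0 // expf_neq0.
Qed.

Lemma Aut_L9 : Aut (@L9 F) = [set M | exists alpha2 beta2 gamma3 : F,
     [/\ beta2 != 0, gamma3 != 0 &
      M = mx3 1            0     0
              alpha2       beta2 0
              (gamma3 - 1) 0     gamma3]].
Proof.
apply/seteqP; split=> M.
  aut_intro M.
  move=> [[/col3_inj[E1 E2 E3] /col3_inj[_ _ E6] /col3_inj[_ _ E9]] [_ _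
    /col3_inj[_ _ E12]] _].
  move: uM E6 E9 E12; rewrite E1 E2; scalar_simp => uM E6 E9 E12.
  have [x33_0 det0] : x33 != 0 /\ x11 * x22 - x12 * x21 != 0.
    by apply: mulf_neq0P; move: uM; congr (_ != _); ring.
  have x11_1 := mulr_fix x33_0 E9.
  have x12_0 : x12 = 0 by apply: (mulr_eq0_l x33_0).
  move: E6 det0; rewrite x12_0 x11_1; scalar_simp => <- x22_0.
  exists x21, x22, x33; split=> //; congr mx3.
  by rewrite E3 x11_1; ring.
move=> [a [b [c [b0 c0 ->]]]]; aut_elim ltac:(ring); by rewrite mulf_neq0.
Qed.

Lemma Aut_L10 (r : F) : r != 0 ->
  Aut (L10 r) = [set M | exists alpha2 beta2 gamma3 : F,
      [/\ beta2 != 0, gamma3 != 0 &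
       M = mx3 1                  0     0
               alpha2             beta2 0
               ((gamma3 - 1) / r) 0     gamma3]].
Proof.
move=> r0; apply/seteqP; split=> M.
  aut_intro M.
  move=> [[/col3_inj[E1 E2 E3] /col3_inj[E4 E5 E6] _] [/col3_inj[E7 E8 E9] _ _]
    _].
  move: uM E2 E3 E5 E9; rewrite E1 E4; scalar_simp => uM E2 E3 E5 /eqP.
  rewrite mulrN1 oppr_eq0 => /eqP x32_0.
  move: uM; rewrite x32_0; scalar_simp =>
    /mulf_neq0P[_ /mulf_neq0P[x22_0 x33_0]].
  have x11_1 := mulr_fix x22_0 E5.
  exists x21, x22, x33; split=> //; congr mx3 => //; first by rewrite E2; ring.
  by rewrite E3 x11_1; field.
move=> [a [b [c [b0 c0 ->]]]]; aut_elim ltac:(field); by rewrite mulf_neq0.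
Qed.

Lemma Aut_L11 : 2%N \notin [pchar F] ->
    Aut (@L11 F) = [set M | exists alpha2 beta2 : F,
      beta2 != 0 /\
      M = mx3 1                        0                    0
              alpha2                   beta2                0
              (- (alpha2 ^+ 2 / 2%:R)) (- (alpha2 * beta2)) (beta2 ^+ 2)].
Proof.
move=> ch2; have two0 : 2%:R != 0 :> F by rewrite inE /= in ch2.
apply/seteqP; split=> M.
  aut_intro M.
  move=> [[/col3_inj[_ _ E3] /col3_inj[E4 E5 E6] _] [_ /col3_inj[E7 E8 E9] _]
    _].
  move: uM E3 E5 E6 E8 E9; rewrite E4 E7; scalar_simp => uM E3 E5 E6 E8 E9.
  move: uM; rewrite E8; scalar_simp => /mulf_neq0P[_ /mulf_neq0P[x22_0 x33_0]].
  have x11_1 := mulr_fix x22_0 E5.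
  exists x21, x22; split=> //; congr mx3 => //.
  - apply/eqP; rewrite -addr_eq0 -(mulrI_eq0 _ (mulfI two0)).
    have -> : 2%:R * (x31 + x21 ^+ 2 / 2%:R) = x11 * x31 * 2%:R + x21 * x21.
      by rewrite x11_1; field.
    by rewrite -E3.
  - apply/subr0_eq; rewrite -(subrr x32) {2}E6 x11_1; ring.
move=> [a [b [b0 ->]]]; aut_elim ltac:(field);
  by rewrite mulf_neq0 // expf_neq0.
Qed.

Lemma Aut_L12 : Aut (@L12 F) = [set M | exists a b c : F,
    a != 0 /\
    M = mx3 a 0        0
            b (a ^+ 2) 0
            c (a * b)  (a ^+ 3)].
Proof.
apply/seteqP; split=> M.
  aut_intro M.
  move=> [[/col3_inj[E1 E2 E3] /col3_inj[E4 E5 E6] _] _ _].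
  move: uM E5; rewrite E1 E4; scalar_simp => /mulf_neq0P[x11_0 _] E5.
  by exists x11, x21, x31; rewrite E3 E5 E6 E2; split=> //; congr mx3; ring.
move=> [a [b [c [a0 ->]]]]; aut_elim ltac:(ring);
  by rewrite !mulf_neq0 // expf_neq0.
Qed.

Lemma Aut_L13 : Aut (@L13 F) = [set M | exists b c : F,
    b != -1 /\
    M = mx3 1 0       0
            b (1 + b) 0
            c b       1].
Proof.
apply/seteqP; split=> M.
  aut_intro M.
  move=> [[/col3_inj[E1 E2 E3] /col3_inj[E4 E5 E6] /col3_inj[_ _ E9]] _ _].
  move: uM E4 E5; rewrite E1; scalar_simp => uM E4.
  move: uM; rewrite E4; scalar_simp => uM.
  have /mulf_neq0P[x11_0 _] := uM.
  have x23_0 : x23 = 0 by apply: (mulr_eq0_l x11_0); rewrite mulrC.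
  move: uM; rewrite x23_0; scalar_simp =>
    /mulf_neq0P[_ /mulf_neq0P[x22_0 _]] E5.
  have x11_1 := mulr_fix x22_0 E5.
  move: E2 E3 E6; rewrite x11_1; scalar_simp => E2 E3 E6.
  exists x21, x31; rewrite E3 E2; split.
    by rewrite -addr_eq0 addrC -E2.
  congr mx3; apply: (addrI x32); rewrite E6 E2 E3; ring.
move=> [b [c [b1 ->]]]; aut_elim ltac:(ring); by rewrite addrC addr_eq0.
Qed.

Lemma Aut_L15 : Aut (@L15 F) = [set M | exists a b : F,
    a != 0 /\
    M = mx3 1           0 0
            (a - 1)     a 0
            (b - a + 1) b a].
Proof.
apply/seteqP; split=> M.
  aut_intro M.
  move=> [[/col3_inj[E1 E2 E3] /col3_inj[_ E5 E6] /col3_inj[E7 E8 E9]] _ _].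
  move: uM E5 E8; rewrite E1 E7; scalar_simp => /mulf_neq0P[x11_0 det0] E5 E8.
  (* The action of a_1 on the ideal has 1 as its only eigenvalue, and an automorphism conjugates it
     into its multiple by [x11]. A factor other than 1 makes the first row of the block vanish. *)
  have x11_1 : x11 = 1.
    apply/eqP/negPn/negP => x11_1.
    have x23_0 : x23 = 0.
      by apply/eqP/negPn/negP => /mulr_fix/(_ E8) E; rewrite E eqxx in x11_1.
    have x22_0 : x22 = 0.
      apply/eqP/negPn/negP => x22_0; case/eqP: x11_1.
      by apply: (mulr_fix x22_0); rewrite -E5 x23_0 addr0.
    by move: det0; rewrite x22_0 x23_0 !mul0r subrr eqxx.
  move: E2 E3 E5 E6 E8 E9; rewrite x11_1; scalar_simp => E2 E3 E5 E6 E8 E9.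
  have x23_0 : x23 = 0 by apply: (addrI x22); rewrite E5 addr0.
  have x33E : x33 = x22 by apply: (addrI x32); rewrite E6 addrC.
  exists x22, x32; split.
    by move: det0; rewrite x23_0 mul0r subr0 => /mulf_neq0P[].
  by rewrite x23_0 x33E; congr mx3; rewrite ?E3 E2; ring.
move=> [a [b [a0 ->]]]; aut_elim ltac:(ring); by rewrite mulf_neq0.
Qed.

End NonNilpotent.

(** * Group structure for L_7 to L_11 *)

Section NonNilpotentGroups.
Variable F : fieldType.

Definition affine_rep (h : scalar_sdprod F) : 'M[F]_3 :=
  mx3 1 0 0 h.1 (uval h.2) 0 0 0 1.

Lemma affine_rep1 : affine_rep 1%g = 1.
Proof. by rewrite mx3_1. Qed.

Lemma affine_repM h h' : affine_rep (h * h')%g = affine_rep h * affine_rep h'.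
Proof.
rewrite /affine_rep mul_mx3.
have -> : (h * h')%g.1 = h.1 + uval h.2 * h'.1 by [].
have -> : uval (h * h')%g.2 = uval h.2 * uval h'.2 by [].
by congr mx3; ring.
Qed.

Lemma affine_rep_inj : injective affine_rep.
Proof. by move=> [b u] [b' u'] /mx3_inj[_ [/= -> /units_inj -> _] _]. Qed.

Definition translation_rep (z : additive_group F) : 'M[F]_3 :=
  mx3 1 0 0 0 1 0 (z : F) 0 1.

Lemma translation_rep1 : translation_rep 1%g = 1.
Proof. by rewrite mx3_1. Qed.

Lemma translation_repM z z' :
  translation_rep (z * z')%g = translation_rep z * translation_rep z'.
Proof.
rewrite /translation_rep mul_mx3.
have -> : (z * z')%g = (z : F) + (z' : F) :> F by [].
by congr mx3; ring.
Qed.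

Lemma translation_rep_inj : injective translation_rep.
Proof. by move=> z z' /mx3_inj[_ _ [-> _ _]]. Qed.

Lemma L7_group : exists P Q,
     [/\ direct (AutG (@L7 F)) P Q, isog P (additive_group F) &
         isog Q (scalar_sdprod F)].
Proof.
apply: (direct_rep translation_rep1 translation_repM affine_rep1 affine_repM
  translation_rep_inj affine_rep_inj).
- by move=> z h /mx3_inj[_ _ [z0 _ _]]; rewrite /translation_rep z0 mx3_1.
- move=> M; rewrite -[product _]/L7 Aut_L7; split.
    move=> [b [u [z [/unitsP[v Ev] ->]]]]; exists z, (b, v).
    by rewrite mulmx_mx3 /= Ev; congr mx3; ring.
  move=> [z [[b u] ->]]; exists b, (uval u), z; split; first exact: units_neq0.
  by rewrite mulmx_mx3 /=; congr mx3; ring.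
- by move=> h z; rewrite !mulmx_mx3; congr mx3; ring.
Qed.

Section Dilation.
Variable k : F.

(** Diagonal with entries 1, 1, [u] in the basis a_1 - a_3 / k, a_2, a_3. The first vector has
    square zero in L_9 for [k = 1] and in L_10 for [k = r]. *)
Definition dilation_rep (u : units F) : 'M[F]_3 :=
  mx3 1 0 0 0 1 0 ((uval u - 1) / k) 0 (uval u).

Lemma dilation_rep1 : dilation_rep 1%g = 1.
Proof. by rewrite /dilation_rep mx3_1 subrr mul0r. Qed.

Lemma dilation_repM u v : dilation_rep (u * v)%g = dilation_rep u *
  dilation_rep v.
Proof.
rewrite /dilation_rep mul_mx3.
have -> : uval (u * v)%g = uval u * uval v by [].
by congr mx3; ring.
Qed.

Lemma dilation_rep_inj : injective dilation_rep.
Proof. by move=> u v /mx3_inj[_ _ [_ _ /units_inj]]. Qed.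

Lemma dilation_affine_direct (t : nat -> nat -> 'cV[F]_3) :
  Aut (product t) = [set M | exists alpha2 beta2 gamma3 : F,
     [/\ beta2 != 0, gamma3 != 0 &
      M = mx3 1            0     0
              alpha2       beta2 0
              ((gamma3 - 1) / k) 0     gamma3]] ->
  exists P Q,
     [/\ direct (AutG (product t)) P Q, isog P (units F) &
         isog Q (scalar_sdprod F)].
Proof.
move=> AutE.
apply: (direct_rep dilation_rep1 dilation_repM affine_rep1 affine_repM
  dilation_rep_inj affine_rep_inj).
- move=> u h /mx3_inj[_ _ [_ _ u1]].
  by rewrite /dilation_rep u1 mx3_1 subrr mul0r.
- move=> M; rewrite AutE; split.
    move=> [b [u [v [/unitsP[u' Eu] /unitsP[v' Ev] ->]]]]; exists v', (b, u').
    by rewrite mulmx_mx3 /= Eu Ev; congr mx3; ring.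
  move=> [v [[b u] ->]]; exists b, (uval u), (uval v).
  split; [exact: units_neq0|exact: units_neq0|].
  by rewrite mulmx_mx3 /=; congr mx3; ring.
- by move=> h z; rewrite !mulmx_mx3; congr mx3; ring.
Qed.

End Dilation.

Lemma L9_group : exists P Q,
     [/\ direct (AutG (@L9 F)) P Q, isog P (units F) &
         isog Q (scalar_sdprod F)].
Proof.
apply: (@dilation_affine_direct 1); rewrite -[product _]/L9 Aut_L9.
by apply/seteqP; split=> M [b [u [v [u0 v0 ->]]]]; exists b, u, v;
  rewrite divr1.
Qed.

Lemma L10_group (r : F) : r != 0 -> exists P Q,
     [/\ direct (AutG (L10 r)) P Q, isog P (units F) &
         isog Q (scalar_sdprod F)].
Proof. by move=> r0; apply: (@dilation_affine_direct r); rewrite -Aut_L10. Qed.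

Lemma L11_group : 2%N \notin [pchar F] ->
  isog (AutG (@L11 F)) (scalar_sdprod F).
Proof.
move=> ch2; have two0 : 2%:R != 0 :> F by rewrite inE /= in ch2.
pose m (h : scalar_sdprod F) : 'M[F]_3 :=
  mx3 1 0 0 h.1 (uval h.2) 0
      (- (h.1 ^+ 2 / 2%:R)) (- (h.1 * uval h.2)) (uval h.2 ^+ 2).
apply: (@isog_rep _ _ m).
- by rewrite /m mx3_1 /= expr0n mul0r oppr0 mul0r oppr0 expr1n.
- move=> h h'; rewrite /m mul_mx3.
  have -> : (h * h')%g.1 = h.1 + uval h.2 * h'.1 by [].
  have -> : uval (h * h')%g.2 = uval h.2 * uval h'.2 by [].
  by congr mx3; field.
- by move=> [b u] [b' u'] /mx3_inj[_ [/= -> /units_inj -> _] _].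
move=> g; rewrite /AutG /= Aut_L11 //; split.
  by move=> [b [u [/unitsP[v Ev] ->]]]; exists (b, v); rewrite /m /= Ev.
by move=> [h ->]; exists h.1, (uval h.2); split; first exact: units_neq0.
Qed.

Section L8.
Variable lambda : F.
Hypothesis ch2 : 2%N \in [pchar F].

Let two0 : 2%:R = 0 :> F. Proof. exact: pcharf0 ch2. Qed.

Lemma sqrB1_char2 (x : F) : (x - 1) ^+ 2 = x ^+ 2 - 1.
Proof. by apply: subr0_eq; rewrite -[RHS](mul0r (1 - x)) -two0; ring. Qed.

Lemma L8_nonsquare_group : ~ (exists mu : F, lambda = mu ^+ 2) ->
  isog (AutG (L8 lambda)) (additive_group F).
Proof.
move=> nsq; apply: (isog_rep translation_rep1 translation_repM
  translation_rep_inj).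
move=> g; rewrite /AutG /= Aut_L8 //; split.
  move=> [a [b [c [b0 ab ->]]]]; exists c.
  (* Otherwise [lambda] would be the square of [a / (b - 1)], because b^2 - 1 = (b - 1)^2 in
     characteristic 2. *)
  have b1 : b = 1.
    apply/eqP/negPn/negP => b1; case: nsq; exists (a / (b - 1)).
    have b1' : b ^+ 2 - 1 != 0 by rewrite -sqrB1_char2 expf_neq0 // subr_eq0.
    by rewrite expr_div_n ab sqrB1_char2 mulfK.
  move: ab; rewrite b1 expr1n subrr mulr0 => /eqP.
  rewrite sqrf_eq0 => /eqP ->.
  by rewrite mul0r.
move=> [z ->]; exists 0, 1, z; split; first exact: oner_neq0.
  by rewrite expr0n expr1n subrr mulr0.
by congr mx3; ring.
Qed.

Lemma L8_square_group : (exists mu : F, lambda = mu ^+ 2) ->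
  exists N K (phi : additive_group F -> units 'M[F]_3)
             (psi : units F -> units 'M[F]_3),
    [/\ semidirect (AutG (L8 lambda)) N K,
        isomorphism phi N, isomorphism psi K &
        forall (u : units F) (z : F),
          (psi u * phi z / psi u)%g = phi (uval u ^+ 2 * z)].
Proof.
move=> [mu lambdaE].
(* Diagonal with entries 1, u, u^2 in the basis a_1 - mu a_2, a_2 - mu a_3, a_3, whose first vector
   has square zero. *)
pose m (u : units F) : 'M[F]_3 :=
  mx3 1 0 0 (mu * (uval u - 1)) (uval u) 0
      (mu ^+ 2 * (uval u ^+ 2 - uval u)) (mu * (uval u - 1) * uval u) (uval u
        ^+ 2).
apply: (semidirect_rep translation_rep1 translation_repM (m2 := m) _ _
  translation_rep_inj _ _ _ (act := fun u z => uval u ^+ 2 * (z : F))).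
- by rewrite /m mx3_1 /= expr1n !subrr !(mulr0, mul0r).
- move=> u v; rewrite /m mul_mx3; have ->
  : uval (u * v)%g = uval u * uval v by [].
  by congr mx3; ring.
- by move=> u v /mx3_inj[_ [_ /units_inj]].
- move=> z u /mx3_inj[_ [_ u1 _] [z0 _ _]].
  by rewrite /translation_rep mx3_1 z0 -u1 expr1n subrr mulr0.
- move=> M; rewrite -[product _]/(L8 lambda) Aut_L8 //; split.
    move=> [a [b [c [/unitsP[u Eu] ab ->]]]].
    exists (c - mu ^+ 2 * (b ^+ 2 - b) : F), u.
    have -> : a = mu * (b - 1).
      (* Square roots are unique in characteristic 2: the square of a difference is the difference
         of the squares. *)
      apply/subr0_eq/eqP; rewrite -sqrf_eq0; apply/eqP.
      transitivity (a ^+ 2 - lambda * (b - 1) ^+ 2 - 2%:R * (a - mu * (b - 1))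
        * (mu * (b - 1))).
        by rewrite lambdaE; ring.
      by rewrite ab two0 sqrB1_char2; ring.
    by rewrite mulmx_mx3 /= Eu; congr mx3; ring.
  move=> [z [u ->]]; exists (mu * (uval u - 1)), (uval u).
  exists ((z : F) + mu ^+ 2 * (uval u ^+ 2 - uval u)); split.
  + exact: units_neq0.
  + by rewrite exprMn -lambdaE sqrB1_char2.
  + by rewrite mulmx_mx3; congr mx3; ring.
- move=> u z; rewrite !mulmx_mx3; congr mx3; ring.
Qed.

End L8.

End NonNilpotentGroups.

(** * Automorphisms of L_14 *)

Section L14.
Variables (F : fieldType) (rho : F).
Hypothesis rho0 : rho != 0.

(** The third and fourth lines of conditions are P A = p A P for the lower block P and A = diag(1,
    rho). They are left unsolved because the shape of P depends on rho. *)
Lemma Aut_L14 : Aut (L14 rho) = [set M | exists p b c x22 x23 x32 x33 : F,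
  [/\ p != 0 /\ x22 * x33 - x23 * x32 != 0,
      x22 = p * (p + b) /\ x32 = rho * p * c,
      x22 = p * x22 /\ x32 = rho * p * x32,
      rho * x23 = p * x23 /\ x33 = p * x33 &
      M = mx3 p 0 0 b x22 x23 c x32 x33]].
Proof.
apply/seteqP; split=> M.
  aut_intro M.
  move=> [[/col3_inj[E1 E2 E3] /col3_inj[_ E5 E6] /col3_inj[E7 E8 E9]] _ _].
  have x13_0 := mulr_eq0_l rho0 E7.
  move: uM E5 E6 E8 E9; rewrite E1 x13_0; scalar_simp => uM E5 E6 E8 E9.
  exists x11, x21, x31, x22, x23, x32, x33; split=> //.
  - exact: mulf_neq0P.
  - by rewrite E3 {1}E2; split; ring.
  - by rewrite {1}E5 {1}E6; split; ring.
  - by split; [rewrite -E8; ring|apply: (mulIf rho0); rewrite E9; ring].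
move=> [p [b [c [x22 [x23 [x32 [x33 [[p0 det0] [E1 E2] [E3 E4] [E5 E6]
  ->]]]]]]]].
aut_elim ltac:(first [ring|rewrite E1; ring|rewrite E2; ring|rewrite {1}E3;
  ring|rewrite {1}E4; ring|rewrite mulrC E5; ring|rewrite {1}E6; ring]);
  exact: mulf_neq0.
Qed.

Definition mx2 (a b c d : F) : 'M[F]_2 :=
  \matrix_(i, j) nth 0 (nth [::] [:: [:: a; b]; [:: c; d]] i) j.

Lemma mx2_eta (A : 'M[F]_2) : A = mx2 (A 0 0) (A 0 1) (A 1 0) (A 1 1).
Proof.
by apply/matrixP=> -[[|[|//]] Hi] -[[|[|//]] Hj]; rewrite mxE /=;
  congr (A _ _); exact: val_inj.
Qed.

Lemma det_mx2 (A : 'M[F]_2) : \det A = A 0 0 * A 1 1 - A 0 1 * A 1 0.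
Proof.
rewrite (expand_det_row _ 0) !big_ord_recr big_ord0 /= /cofactor !det_mx11 !mxE
  /=.
rewrite add0r expr0 expr1 mul1r mulN1r mulrN.
by congr (A _ _ * A _ _ - A _ _ * A _ _); exact: val_inj.
Qed.

Lemma mulmx2E (A B : 'M[F]_2) i j : (A *m B) i j = A i 0 * B 0 j + A i 1 * B 1
  j.
Proof.
rewrite mxE !big_ord_recr big_ord0 /= add0r.
by congr (A _ _ * B _ _ + A _ _ * B _ _); exact: val_inj.
Qed.

(** Fixes a_1 - a_2, which has square zero in L_14, and acts by [B] on the span of a_2 and a_3. *)
Definition GL2_rep (A : units 'M[F]_2) : 'M[F]_3 :=
  let B := uval A in
  mx3 1 0 0 (B 0 0 - 1) (B 0 0) (B 0 1) (B 1 0) (B 1 0) (B 1 1).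

Lemma L14_group_1 : rho = 1 -> isog (AutG (L14 rho)) (units 'M[F]_2).
Proof.
move=> rho1; apply: (@isog_rep _ _ GL2_rep).
- by rewrite /GL2_rep !mxE /= subrr mx3_1.
- move=> A B; rewrite /GL2_rep mul_mx3.
  have -> : uval (A * B)%g = uval A *m uval B by [].
  by rewrite !mulmx2E; congr mx3; ring.
- move=> A B /mx3_inj[_ [_ E1 E2] [E3 _ E4]]; apply: val_inj => /=.
  by rewrite [LHS]mx2_eta [RHS]mx2_eta E1 E2 E3 E4.
move=> g; rewrite /AutG /= Aut_L14; split.
  move=> [p [b [c [x22 [x23 [x32 [x33 [[p0 det0] [E1 E2] [E3 E4] [E5 E6]
    ->]]]]]]]].
  rewrite rho1 !mul1r in E2 E4 E5.
  have p1 : p = 1.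
    apply/eqP/negPn/negP => p1; move: det0.
    have fix0 x : x = p * x -> x = 0.
      move=> E; apply: (mulr_eq0_l (y := 1 - p));
        first by rewrite subr_eq0 eq_sym.
      by rewrite mulrBr mulr1 [X in _ - X]mulrC -E subrr.
    by rewrite (fix0 _ E3) (fix0 _ E5) !mul0r subrr eqxx.
  have uA : mx2 x22 x23 x32 x33 \is a GRing.unit.
    by rewrite -[_ \is a _]/(_ \in unitmx) unitmxE unitfE det_mx2 !mxE.
  exists (Units uA); rewrite /GL2_rep /= !mxE /= p1 E1 E2 p1.
  by congr mx3; ring.
move=> [A ->]; have := uvalP A.
rewrite -[_ \is a _]/(_ \in unitmx) unitmxE unitfE det_mx2 => det0.
do 7!eexists; split; last by reflexivity.
all: rewrite ?rho1; split; rewrite ?oner_neq0 //; ring.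
Qed.

Lemma L14_torus_cases M : rho != 1 -> Aut (L14 rho) M <->
  (exists u v, [/\ u != 0, v != 0 & M = mx3 1 0 0 (u - 1) u 0 0 0 v]) \/
  [/\ rho = -1, (2%:R : F) != 0 & exists u v,
    [/\ u != 0, v != 0 & M = mx3 (-1) 0 0 1 0 u v v 0]].
Proof.
move=> rho1; have rho1' : 1 - rho != 0 by rewrite subr_eq0 eq_sym.
rewrite Aut_L14; split.
  move=> [p [b [c [x22 [x23 [x32 [x33 [[p0 det0] [E1 E2] [E3 E4] [E5 E6]
    ->]]]]]]]].
  have [p1|p1] := eqVneq p 1.
    rewrite p1 ?mul1r ?mulr1 in E1 E2 E3 E4 E5; left.
    have x32_0 : x32 = 0.
      apply: (mulr_eq0_l rho1');
        rewrite mulrBr mulr1 [X in _ - X]mulrC -E4 subrr.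
      by [].
    have x23_0 : x23 = 0.
      apply: (mulr_eq0_l rho1');
        rewrite mulrBr mulr1 [X in _ - X]mulrC E5 subrr.
      by [].
    have c0 : c = 0 by apply: (mulr_eq0_l rho0); rewrite mulrC -E2.
    move: det0; rewrite x23_0 mul0r subr0 => /mulf_neq0P[x22_0 x33_0].
    exists x22, x33; split=> //; rewrite p1 x32_0 c0 E1; congr mx3; ring.
  right.
  have x22_0 : x22 = 0.
    by apply/eqP/negPn/negP => /mulr_fix/(_ E3)/eqP; apply/negP.
  have x33_0 : x33 = 0.
    by apply/eqP/negPn/negP => /mulr_fix/(_ E6)/eqP; apply/negP.
  move: det0; rewrite x22_0 mul0r sub0r oppr_eq0 => /mulf_neq0P[x23_0 x32_0].
  have rhop := mulr_fix x32_0 E4; have prho := mulIf x23_0 E5.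
  have /eqP : (rho - 1) * (rho + 1) = 0.
    by rewrite -[RHS](subrr 1) -{3}rhop -prho; ring.
  rewrite mulf_eq0 subr_eq0 (negPf rho1) /= addr_eq0 => /eqP rhoN1.
  have pN1 : p = -1 by rewrite -prho.
  split=> //.
    by apply: contraNneq rho1 => two0; rewrite rhoN1 eq_sym -addr_eq0 -two0.
  exists x23, x32; split=> //.
  have b1 : b = 1.
    apply: (addrI p); apply: (mulfI p0); rewrite -E1 x22_0 pN1; ring.
  by rewrite x33_0 b1 E2 rhop mul1r pN1.
case=> [[u [v [u0 v0 ->]]]|[rhoN1 two0 [u [v [u0 v0 ->]]]]].
  exists 1, (u - 1), 0, u, 0, 0, v; split=> //.
  - by rewrite oner_neq0 mul0r subr0 mulf_neq0.
  - by split; ring.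
  - by split; ring.
  by split; ring.
exists (-1), 1, v, 0, u, v, 0; rewrite rhoN1; split=> //.
- by rewrite oppr_eq0 oner_neq0 mul0r sub0r oppr_eq0 mulf_neq0.
- by split; ring.
- by split; ring.
by split; ring.
Qed.

Definition L14_torus (h : units F * units F) : 'M[F]_3 :=
  mx3 1 0 0 (uval h.1 - 1) (uval h.1) 0 0 0 (uval h.2).

Lemma L14_torus1 : L14_torus 1%g = 1.
Proof. by rewrite /L14_torus mx3_1 subrr. Qed.

Lemma L14_torusM h h' : L14_torus (h * h')%g = L14_torus h * L14_torus h'.
Proof.
rewrite /L14_torus mul_mx3.
have -> : uval (h * h')%g.1 = uval h.1 * uval h'.1 by [].
have -> : uval (h * h')%g.2 = uval h.2 * uval h'.2 by [].
by congr mx3; ring.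
Qed.

Lemma L14_torus_inj : injective L14_torus.
Proof.
by move=> [u v] [u' v'] /mx3_inj[_ [_ /units_inj/= -> _] [_ _ /units_inj/= ->]].
Qed.

Lemma L14_group_generic : rho != 1 -> (2%N \in [pchar F]) || (rho != -1) ->
  isog (AutG (L14 rho)) (units F * units F)%type.
Proof.
move=> rho1 rhoN1; apply: (isog_rep L14_torus1 L14_torusM L14_torus_inj).
move=> g; rewrite /AutG /= L14_torus_cases //; split.
  case=> [[_ [_ [/unitsP[u <-] /unitsP[v <-] Eg]]]|[/eqP E two0 _]].
    by exists (u, v).
  by move: rhoN1; rewrite E orbF inE /= (negPf two0).
move=> [h Eg]; left; exists (uval h.1), (uval h.2).
by split=> //; exact: units_neq0.
Qed.

Lemma L14_group_N1 : 2%N \notin [pchar F] -> rho = -1 ->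
  exists N K (phi : (units F * units F)%type -> units 'M[F]_3),
    [/\ semidirect (AutG (L14 rho)) N K, isomorphism phi N, order_two K &
        forall s, K s -> s <> 1%g ->
          forall u v, (s * phi (u, v) / s)%g = phi (v, u)].
Proof.
move=> ch2 rhoN1; have two0 : (2%:R : F) != 0 by rewrite inE /= in ch2.
have rho1 : rho != 1.
  by rewrite rhoN1 eq_sym -addr_eq0 -[1 + 1]/(2%:R).
(* Negates a_1 - a_2 and interchanges a_2 and a_3. *)
pose S : 'M[F]_3 := mx3 (-1) 0 0 1 0 1 1 1 0.
have sA : subgroup (AutG (L14 rho)) := subgroup_AutG _.
have SS : S *m S = 1 by rewrite mulmx_mx3 mx3_1; congr mx3; ring.
have SN h : S <> L14_torus h.
  move=> /mx3_inj[[/eqP]].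
  by rewrite eq_sym -addr_eq0 -[1 + 1]/(2%:R) (negPf two0).
have actE h : S *m L14_torus h = L14_torus (h.2, h.1) *m S.
  by rewrite !mulmx_mx3; congr mx3; rewrite /=; ring.
have [|N [K [phi [semi iso ord act]]]] := semidirect_involution
  L14_torus1 L14_torusM L14_torus_inj sA SS SN actE.
  move=> g; rewrite /AutG /= L14_torus_cases //; split.
    case=> [[_ [_ [/unitsP[u <-] /unitsP[v <-] Eg]]]|
      [_ _ [_ [_ [/unitsP[u <-] /unitsP[v <-] Eg]]]]].
      by left; exists (u, v).
    by right; exists (u, v); rewrite Eg mulmx_mx3; congr mx3; rewrite /=; ring.
  case=> -[h Eg]; [left|right; split=> //];
    exists (uval h.1), (uval h.2); split; try exact: units_neq0.
    exact: Eg.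
  by rewrite Eg mulmx_mx3; congr mx3; ring.
by exists N, K, phi; split=> // s Ks s1 u v; rewrite act.
Qed.

End L14.

(** * Automorphisms of L_16 *)

Section L16.
Variables (F : fieldType) (beta gamma : F).

Lemma size_L16_poly : size ('X^2 - gamma *: 'X - beta%:P) = 3%N.
Proof.
rewrite -addrA size_polyDl size_polyXn //.
rewrite (leq_ltn_trans (size_polyD _ _)) // !size_polyN gtn_max.
rewrite (leq_ltn_trans (size_scale_leq _ _)) ?size_polyX //=.
by rewrite (leq_ltn_trans (size_polyC_leq1 _)).
Qed.

Lemma horner_L16_poly (x : F) :
  ('X^2 - gamma *: 'X - beta%:P).[x] = x ^+ 2 - gamma * x - beta.
Proof. by rewrite !hornerE. Qed.

Hypothesis param : L16_param beta gamma.

Lemma L16_no_root (x : F) : x ^+ 2 - gamma * x - beta != 0.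
Proof.
rewrite -horner_L16_poly -[_ == 0]/(root _ x); apply/negP => rx.
have [_ irr] := param.
have := irr ('X - x%:P); rewrite size_XsubC dvdp_XsubCl => /(_ isT rx).
by move=> /eqp_size; rewrite size_XsubC size_L16_poly.
Qed.

Lemma L16_beta_neq0 : beta != 0.
Proof.
by have := L16_no_root 0; rewrite expr0n mulr0 subr0 sub0r oppr_eq0.
Qed.

Lemma anisotropic16 (a b : F) : a ^+ 2 - gamma * a * b - beta * b ^+ 2 = 0 ->
  a = 0 /\ b = 0.
Proof.
move=> E; have b0 : b = 0.
  apply/eqP/negPn/negP => b0; have /eqP[] := L16_no_root (a / b).
  by rewrite -[RHS](mul0r (b ^- 2)) -E; field.
by move: E; rewrite b0 expr0n !mulr0 !subr0 => /eqP; rewrite sqrf_eq0 => /eqP.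
Qed.

(** Identify the span of a_2 and a_3 with E by a_2 = 1 and a_3 = theta, so that a_1 acts as theta.
    The matrix multiplies E by a + b theta and fixes a_1 - 1 / theta, a vector of square zero; the
    first column contains (a + b theta - 1) / theta, where 1 / theta = (theta - gamma) / beta. *)
Definition L16_plus (a b : F) : 'M[F]_3 :=
  mx3 1                                0 0
      (b - gamma * (a - 1) / beta)     a (beta * b)
      ((a - 1) / beta)                 b (a + gamma * b).

(** For gamma = 0 this is the conjugation theta -> - theta followed by multiplication by a + b theta
    on E, with a_1 - 1 / theta negated. *)
Definition L16_minus (a b : F) : 'M[F]_3 :=
  mx3 (-1)             0 0
      (- b)            a (- (beta * b))
      ((1 - a) / beta) b (- a).

(** The action of a_1 on the ideal, with trace gamma and determinant - beta, is conjugate to its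
    multiple by [x11]. So x11^2 = 1, and x11 = -1 other than 1 requires gamma = 0. The proof reaches
    this by eliminating entries. *)
Lemma Aut_L16_cases M : Aut (L16 beta gamma) M <->
  (exists a b, (a, b) != (0, 0) /\ M = L16_plus a b) \/
  [/\ gamma = 0, (2%:R : F) != 0 &
      exists a b, (a, b) != (0, 0) /\ M = L16_minus a b].
Proof.
have beta0 := L16_beta_neq0; split.
  aut_intro M.
  move=> [[/col3_inj[E1 E2 E3] /col3_inj[E4 E5 E6] /col3_inj[_ E7 E8]] _ _].
  move: uM E5 E6 E7 E8; rewrite E1 E4; scalar_simp =>
    /mulf_neq0P[x11_0 det0] E5 E6 E7 E8.
  have ab0 : (x22, x32) != (0, 0).
    rewrite pair_neq0 -negb_and; apply: contraNN det0 =>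
      /andP[/eqP x22_0 /eqP x32_0].
    by rewrite x22_0 x32_0 mul0r mulr0 subrr.
  have [x11_1|x11_1] := eqVneq x11 1.
    rewrite x11_1 !mul1r in E2 E3 E5 E6; left; exists x22, x32; split=> //.
    have x31E : x31 = (x22 - 1) / beta by rewrite E2; field.
    rewrite /L16_plus x11_1 E5 E6; congr mx3 => //; try ring.
    by rewrite E3 x31E; field.
  right; have q0 : 1 - x11 != 0 by rewrite subr_eq0 eq_sym.
  have E7' : x22 * (1 + x11) + gamma * x11 * x32 = 0.
    apply: (mulr_eq0_l (mulf_neq0 beta0 q0)).
    transitivity (x22 * beta + x23 * gamma - x11 * x33 * beta).
      by rewrite E5 E6; ring.
    by rewrite E7 subrr.
  have E8' : beta * x32 * (1 + x11) + gamma * x11 * (x22 + gamma * x32) = 0.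
    apply: (mulr_eq0_l q0).
    transitivity (x32 * beta + x33 * gamma - (x11 * x23 + x11 * x33 * gamma)).
      by rewrite E5 E6; ring.
    by rewrite E8 subrr.
  have /eqP : 1 + x11 = 0.
    apply/eqP/negPn/negP => k0; move/negP: ab0; apply.
    have x22E : x22 = - (gamma * x11 / (1 + x11)) * x32.
      apply: (mulIf k0); apply: subr0_eq; rewrite -[RHS]E7'; field.
      by [].
    have x32_0 : x32 = 0.
      (* Eliminating [x22] turns [E8'] into [x32] times a value of X^2 - gamma X - beta, up to a
         nonzero factor. *)
      apply: (mulr_eq0_l (L16_no_root (gamma * x11 / (1 + x11)))).
      apply: (mulIf k0); rewrite mul0r -[RHS]oppr0 -[in RHS]E8' x22E; field.
      by [].
    by rewrite x22E x32_0 mulr0.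
  rewrite addrC addr_eq0 => /eqP x11_N1.
  have two0 : (2%:R : F) != 0.
    by apply: contraNneq x11_1 => two0; rewrite x11_N1 eq_sym -addr_eq0 -two0.
  have gamma0 : gamma = 0.
    apply/eqP/negPn/negP => g0; move/negP: ab0; apply.
    have x32_0 : x32 = 0.
      apply: (mulr_eq0_l (y := - gamma)); first by rewrite oppr_eq0.
      by rewrite -[RHS]E7' x11_N1; ring.
    have x22_0 : x22 = 0.
      apply: (mulr_eq0_l (y := - gamma)); first by rewrite oppr_eq0.
      by rewrite -[RHS]E8' x11_N1 x32_0; ring.
    by rewrite x22_0 x32_0.
  split=> //; exists x22, x32; split=> //.
  have x31E : x31 = (1 - x22) / beta by rewrite E2 x11_N1; field.
  rewrite /L16_minus E5 E6 x31E x11_N1 gamma0; congr mx3; try ring.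
  by rewrite E3 x11_N1 gamma0; ring.
(* This is the norm of a + b theta, and the determinant of [L16_plus a b]. *)
have norm_neq0 a b : (a, b) != (0, 0) ->
  a ^+ 2 + gamma * a * b - beta * b ^+ 2 != 0.
  move=> ab0; apply: contraNneq ab0 => E.
  have [|a0 /eqP] := @anisotropic16 a (- b); first by rewrite -[RHS]E; ring.
  by rewrite oppr_eq0 => /eqP b0; rewrite a0 b0.
case=> [[a [b [/norm_neq0 ab0 ->]]]|[g0 two0 [a [b [/norm_neq0 ab0 ->]]]]].
  rewrite /L16_plus; aut_elim ltac:(field).
    by move: ab0; congr (_ != _); ring.
rewrite /L16_minus g0; aut_elim ltac:(field).
  by move: ab0; rewrite g0; congr (_ != _); ring.
Qed.

Section Extension.
Variables (E : fieldExtType F) (theta : E).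
Hypothesis gen : <<1%VS; theta>>%VS = fullv.
Hypothesis theta2 : theta ^+ 2 = gamma *: theta + beta%:A.

Let m (co : E -> F * F) (u : units E) : 'M[F]_3 :=
  L16_plus (co (uval u)).1 (co (uval u)).2.

Lemma L16_torus : exists co : E -> F * F,
  [/\ [/\ m co 1%g = 1, forall u v,
    m co (u * v)%g = m co u * m co v & injective (m co)],
      forall u : units E, co (uval u) != (0, 0) &
      forall a b, (a, b) != (0, 0) -> exists u : units E,
        uval u = a%:A + b *: theta /\ co (uval u) = (a, b)].
Proof.
have beta0 := L16_beta_neq0.
have [co [coE coK]] := quadratic_coords gen theta2 L16_no_root; exists co.
have coM u v : co (u * v) = ((co u).1 * (co v).1 + beta * ((co u).2 * (co v).2),
    (co u).1 * (co v).2 + (co u).2 * (co v).1 + gamma * ((co u).2 * (co v).2)).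
  by rewrite {1}[u]coE {1}[v]coE (quadratic_mul theta2) coK.
split; first split.
- have co1 : co 1 = (1, 0) by rewrite -[RHS]coK scale1r scale0r addr0.
  by rewrite /m /L16_plus co1 mx3_1 /=; congr mx3; field.
- move=> u v; rewrite /m; have -> : uval (u * v)%g = uval u * uval v by [].
  rewrite coM; case: (co (uval u)) => a b; case: (co (uval v)) => c d /=.
  by rewrite mul_mx3; congr mx3; field.
- move=> u v; rewrite /m => E12; apply: val_inj => /=.
  rewrite [LHS]coE [RHS]coE; move: E12.
  case: (co (uval u)) => a b; case: (co (uval v)) => c d /=.
  by move=> /mx3_inj[_ [_ -> _] [_ -> _]].
- move=> u; apply/eqP => E0; have := uvalP u;
  rewrite [uval u]coE E0 !scale0r addr0.
  by rewrite unitr0.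
move=> a b ab0; have : a%:A + b *: theta \is a GRing.unit.
  rewrite unitfE; apply: contraNneq ab0.
  by move=> /(quadratic_free theta2 L16_no_root)[-> ->].
by move=> uu; exists (Units uu); rewrite /= coK.
Qed.

Lemma L16_group_plus : (gamma != 0) || (2%N \in [pchar F]) ->
  isog (AutG (L16 beta gamma)) (units E).
Proof.
move=> gamma2; have [co [[m1 mM m_inj] co0 coP]] := L16_torus.
apply: (isog_rep m1 mM m_inj) => g; rewrite /AutG /= Aut_L16_cases; split.
  case=> [[a [b [/coP[u [_ Eu]] Eg]]]|[/eqP g0 two0 _]].
    by exists u; rewrite /m Eu.
  by move: gamma2; rewrite g0 inE /= (negPf two0).
by move=> [u Eg]; left; exists (co (uval u)).1, (co (uval u)).2;
  rewrite -surjective_pairing.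
Qed.

Lemma L16_group_minus : 2%N \notin [pchar F] -> gamma = 0 ->
  exists N K, [/\ semidirect (AutG (L16 beta gamma)) N K,
                  isog N (units E) & order_two K].
Proof.
move=> ch2 gamma0; have two0 : (2%:R : F) != 0 by rewrite inE /= in ch2.
have [co [[m1 mM m_inj] co0 coP]] := L16_torus.
have conj_exists (u : units E) : exists v : units E,
    co (uval v) = ((co (uval u)).1, - (co (uval u)).2).
  have [|v [_ Ev]] := coP (co (uval u)).1 (- (co (uval u)).2); last by exists v.
  have := co0 u; rewrite {1}[co _]surjective_pairing !pair_neq0.
  by rewrite oppr_eq0.
have [act actE] := choice conj_exists.
have sA : subgroup (AutG (L16 beta gamma)) := subgroup_AutG _.
(* Galois conjugation on E, with a_1 negated; [act] is its effect on units. *)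
pose S : 'M[F]_3 := mx3 (-1) 0 0 0 1 0 0 0 (-1).
have SS : S *m S = 1 by rewrite mulmx_mx3 mx3_1; congr mx3; ring.
have SN u : S <> m co u.
  move=> /mx3_inj[[/eqP]].
  by rewrite eq_sym -addr_eq0 -[1 + 1]/(2%:R) (negPf two0).
have SmE u : S *m m co u = m co (act u) *m S.
  by rewrite /m actE !mulmx_mx3 /= gamma0; congr mx3; ring.
have mSE u : m co u *m S = L16_minus (co (uval u)).1 (co (uval u)).2.
  by rewrite mulmx_mx3 gamma0; congr mx3; ring.
have [|N [K [phi [semi iso ord _]]]] := semidirect_involution m1 mM m_inj sA SS
  SN SmE;
  last by exists N, K; split=> //; exists phi.
move=> g; rewrite /AutG /= Aut_L16_cases; split.
  case=> [[a [b [/coP[u [_ Eu]] Eg]]]|[_ _ [a [b [/coP[u [_ Eu]] Eg]]]]].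
    by left; exists u; rewrite /m Eu.
  by right; exists u; rewrite mSE Eu.
case=> -[u Eg]; [left|right; split=> //]; exists (co (uval u)).1,
  (co (uval u)).2;
  rewrite -surjective_pairing; split=> //.
by rewrite Eg mSE.
Qed.

End Extension.

End L16.

(** * Classification *)

Section Classification.
Variables (F : fieldType) (L : lmodType F) (br : L -> L -> L).

Definition classified : Prop :=
    alg_iso br L1 \/
    alg_iso br L2 \/
    (exists alpha : F, [/\ alpha != 0, alpha != -1 & alg_iso br (L3 alpha)]) \/
    alg_iso br L4 \/
    (exists2 beta : F, L5_param beta & alg_iso br (L5 beta)) \/
    (exists2 delta : F, L6_param delta & alg_iso br (L6 delta)) \/
    alg_iso br L7 \/
    (2%N \in [pchar F] /\ exists lambda : F, alg_iso br (L8 lambda)) \/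
    alg_iso br L9 \/
    (exists2 r : F, r != 0 & alg_iso br (L10 r)) \/
    (2%N \notin [pchar F] /\ alg_iso br L11) \/
    alg_iso br L12 \/
    alg_iso br L13 \/
    (exists2 rho : F, rho != 0 & alg_iso br (L14 rho)) \/
    alg_iso br L15 \/
    (exists beta gamma : F,
       L16_param beta gamma /\ alg_iso br (L16 beta gamma)).

(** Here [beta] and [gamma] are arbitrary. If the polynomial has a root [r], the other root is [s],
    and the algebra depends on which of them vanish and whether they coincide. *)
Lemma classify_cyclic (beta gamma : F) : alg_iso br (L16 beta gamma) ->
  classified.
Proof.
move=> iso; have [[r rE]|no_root] := pselect (exists r : F,
  r ^+ 2 - gamma * r - beta = 0);
  last first.
  do 15!right; exists beta, gamma; split=> //.
  apply: cubic_irreducible; rewrite ?size_L16_poly // => x.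
  apply/negP; rewrite rootE horner_L16_poly => /eqP E; apply: no_root.
  by exists x.
pose s := gamma - r.
have gammaE : gamma = r + s by rewrite /s addrC subrK.
have betaE : beta = - (r * s).
  by apply/esym/subr0_eq; rewrite -[RHS]rE gammaE; ring.
clearbody s; subst beta gamma.
have L13_case (u : F) : u != 0 -> alg_iso br (L16 0 u) -> classified.
  move=> u0 isou; do 12!right; left.
  (* Scaling a_1 by 1 / u makes the nonzero eigenvalue 1. The third vector is [b_1, b_2] - b_2,
     which b_1 annihilates. *)
  change_basis (mx3 u^-1 0 0 0 (u ^- 2) (- u ^- 2) 0 0 (u ^- 3)) isou
    ltac:(field).
    by rewrite !mulf_neq0 // invr_neq0 // expf_neq0.
have [r0|r0] := eqVneq r 0.
  rewrite r0 mul0r oppr0 add0r in iso.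
  have [s0|s0] := eqVneq s 0; last exact: L13_case iso.
  rewrite s0 in iso; do 11!right; left.
  change_basis (mx3 (1 : F) 0 0 0 1 0 0 0 1) iso ltac:(ring); exact: oner_neq0.
have [s0|s0] := eqVneq s 0.
  by rewrite s0 mulr0 oppr0 addr0 in iso; apply: L13_case iso.
have [sr|sr] := eqVneq s r.
  subst s; do 14!right; left.
  change_basis (mx3 r^-1 0 0 0 (r ^- 2) (- r ^- 2) 0 0 (r ^- 3)) iso
    ltac:(field).
    by rewrite !mulf_neq0 // invr_neq0 // expf_neq0.
do 13!right; left; exists (s / r); first by rewrite mulf_neq0 // invr_neq0.
(* The shift by - (r s)^-1 a_2 makes the square of the first vector an eigenvector for [r]. The
   third vector, [a_1, a_2] - r a_2, is an eigenvector for [s]. *)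
change_basis (mx3 r^-1 0 0 (- (r * s)^-1) (r ^- 2) (- r) 0 (- (s * r ^+ 2)^-1)
  1) iso ltac:(field; rewrite ?r0 ?s0).
  rewrite -subr_eq0 in sr.
  have -> : r^-1 * (r ^- 2 - - r * - (s * r ^+ 2)^-1) = (s - r) / (r ^+ 3 * s)
    by field; rewrite r0 s0.
  by rewrite mulf_neq0 // invr_neq0 // mulf_neq0 // expf_neq0.
Qed.

End Classification.

(** * Squares spanning a plane; normal forms of bilinear forms *)

Section Classification.
Variables (F : fieldType) (L : lmodType F) (br : L -> L -> L).
Notation classified := (classified br).

(* The basis is x, [x, x], [z, z], where the last two vectors span the ideal
   generated by the squares. *)
Definition ideal2_table (p q m n : F) (i j : nat) : 'cV[F]_3 :=
  match i, j with
  | 1, 1 => a2 F | 1, 2 => p *: a2 F + q *: a3 F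
  | 1, 3 => m *: a2 F + n *: a3 F | _, _ => 0 end.

(** Adding an element of the ideal to a_1 keeps the action on the ideal and changes the square of
    a_1. Unless the action is scalar, the square can be made a cyclic vector; for [q] nonzero it
    already is one. *)
Lemma classify_ideal2 p q m n : (q, n) != (0, 0) ->
  alg_iso br (product (ideal2_table p q m n)) -> classified.
Proof.
rewrite pair_neq0 => qn0 iso.
have [q0|q0] := eqVneq q 0; last first.
  apply: (@classify_cyclic _ _ _ (q * m - n * p) (p + n)).
  change_basis (mx3 1 0 0 0 1 p 0 0 q) iso ltac:(ring) => //.
subst q; rewrite eqxx /= in qn0.
(* [(n - p) * (1 + s * p) - p * m] is, up to a nonzero factor, the determinant
   of y, [y, y], [y, [y, y]] for y = a_1 + s a_2 + a_3. *)
have cyclic s : (n - p) * (1 + s * p) - p * m != 0 -> classified.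
  move=> D0; apply: (@classify_cyclic _ _ _ (- (p * n)) (p + n)).
  change_basis (mx3 1 0 0 s (1 + m + s * p) (p * (1 + m + s * p) + n * m)
                    1 n (n ^+ 2)) iso ltac:(ring).
    by move: (mulf_neq0 qn0 D0); congr (_ != _); ring.
have [p0|p0] := eqVneq p 0.
  by apply: (cyclic 0); rewrite p0 !(mul0r, subr0, addr0, mulr1).
have [np|np] := eqVneq n p; last first.
  (* Chosen so that the determinant factor equals 1. *)
  apply: (cyclic (((p * m + 1) / (n - p) - 1) / p)).
  have np' : n - p != 0 by rewrite subr_eq0.
  have -> : (n - p) * (1 + ((p * m + 1) / (n - p) - 1) / p * p) - p * m = 1.
    by field; rewrite p0 np'.
  exact: oner_neq0.
subst n; have [m0|m0] := eqVneq m 0; last first.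
  by apply: (cyclic 0); rewrite subrr mul0r sub0r oppr_eq0 mulf_neq0.
subst m; do 13!right; left; exists 1; first exact: oner_neq0.
change_basis (mx3 p^-1 0 0 0 (p ^- 2) 0 0 0 1) iso ltac:(field).
  by rewrite mulf_neq0 // invr_neq0 // expf_neq0.
Qed.

Lemma classify_form (sigma tau : F) :
  alg_iso br (form_alg 1 sigma 0 tau) -> classified.
Proof.
move=> iso; have [sigma0|sigma0] := eqVneq sigma 0.
  subst sigma; have [tau0|tau0] := eqVneq tau 0.
    by subst tau; left; rewrite L1E.
  have [[r rE]|no_root] := pselect (exists r : F, r ^+ 2 + tau = 0); last first.
    do 4!right; left; exists tau; last by rewrite L5E.
    move=> x; apply/negP; rewrite rootE !hornerE => /eqP E; apply: no_root.
    by exists x.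
  have r0 : r != 0.
    by apply: contraNneq tau0 => r0; rewrite -rE r0 expr0n add0r.
  have tauE : tau = - r ^+ 2.
    by apply/eqP; rewrite -addr_eq0 addrC rE.
  have iso' : alg_iso br (form_alg 1 1 1 0).
    (* The second vector is the isotropic vector r a_1 + a_2, divided by [r]. *)
    change_basis (mx3 1 1 0 0 r^-1 0 0 0 1) iso ltac:(rewrite ?tauE; field);
      by rewrite invr_neq0.
  (* In characteristic 2 the parameter 1 is the value -1 excluded from L_3, and the algebra is
     L_4. *)
  have [two0|two0] := eqVneq (1 : F) (-1).
    by do 3!right; left; rewrite L4E -two0.
  by do 2!right; left; exists 1; rewrite oner_neq0 two0 L3E.
have {}iso : alg_iso br (form_alg 1 1 0 (tau / sigma ^+ 2)).
  change_basis (mx3 1 0 0 0 sigma^-1 0 0 0 1) iso ltac:(field);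
    by rewrite invr_neq0.
move: (tau / _) iso => delta iso.
have [delta0|delta0] := eqVneq delta 0.
  by rewrite delta0 in iso; right; left; rewrite L2E.
have [[r rE]|no_root] := pselect (exists r : F, r ^+ 2 + r + delta = 0);
  last first.
  do 5!right; left; exists delta; last by rewrite L6E.
  move=> x; apply/negP; rewrite rootE !hornerE => /eqP E; apply: no_root.
  by exists x.
have r0 : r != 0.
  by apply: contraNneq delta0 => r0; rewrite -rE r0 expr0n !add0r.
have rN1 : r + 1 != 0.
  apply: contraNneq delta0 => rN1; rewrite -rE.
  have -> : r ^+ 2 + r + delta = r * (r + 1) + delta by ring.
  by rewrite rN1 mulr0 add0r.
(* The vector r a_1 + a_2 is isotropic. *)
have deltaE : delta = - (r ^+ 2 + r).
  by apply/eqP; rewrite -addr_eq0 addrC rE.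
have {}iso : alg_iso br (form_alg 1 ((r + 1) / r) 1 0).
  change_basis (mx3 1 1 0 0 r^-1 0 0 0 1) iso ltac:(rewrite ?deltaE; field);
    by rewrite invr_neq0.
have [alphaN1|alphaN1] := eqVneq ((r + 1) / r) (-1).
  by do 3!right; left; rewrite L4E -alphaN1.
do 2!right; left; exists ((r + 1) / r); rewrite L3E; split=> //.
by rewrite mulf_neq0 // invr_neq0.
Qed.

End Classification.

(** * Squares spanning a line *)

Section Classification.
Variables (F : fieldType) (L : lmodType F) (br : L -> L -> L).
Notation classified := (classified br).

(* The basis is x, y, c, where c spans the ideal generated by the squares. *)
Definition ideal1_table (l p q mu nu ka r s : F) (i j : nat) : 'cV[F]_3 :=
  match i, j with
  | 1, 1 => col3 0 0 l | 1, 2 => col3 p q mu | 1, 3 => col3 0 0 r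
  | 2, 1 => col3 (- p) (- q) nu | 2, 2 => col3 0 0 ka | 2, 3 => col3 0 0 s
  | _, _ => 0 end.

Lemma ideal1_product l p q mu nu ka r s x1 x2 x3 y1 y2 y3 :
  product (ideal1_table l p q mu nu ka r s) (col3 x1 x2 x3) (col3 y1 y2 y3) =
  col3 (p * (x1 * y2 - x2 * y1)) (q * (x1 * y2 - x2 * y1))
    (l * (x1 * y1) + mu * (x1 * y2) + nu * (x2 * y1) + ka * (x2 * y2)
     + r * (x1 * y3) + s * (x2 * y3)).
Proof. by col3_simp; congr col3; ring. Qed.

(** [E1] and [E2] amount to s = r nu and r ka = s mu. Replacing y by y - nu x removes [y, x]; if [r]
    is not zero, this vector annihilates everything from the left and, after a correction along c,
    from the right as well. *)
Lemma classify_abelian_quotient mu nu ka r s :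
  alg_iso br (product (ideal1_table 1 0 0 mu nu ka r s)) ->
  left_leibniz (product (ideal1_table 1 0 0 mu nu ka r s)) -> classified.
Proof.
move=> iso leib.
have := leib (col3 1 0 0) (col3 0 1 0) (col3 1 0 0).
rewrite !ideal1_product col3D => /col3_inj[_ _]; scalar_simp => E1.
have := leib (col3 1 0 0) (col3 0 1 0) (col3 0 1 0).
rewrite !ideal1_product col3D => /col3_inj[_ _]; scalar_simp => E2.
have [r0|r0] := eqVneq r 0.
  rewrite r0 mul0r in E1; subst r s.
  apply: (@classify_form _ _ _ (mu - nu) (ka - nu * mu)).
  change_basis (mx3 1 (- nu) 0 0 1 0 0 0 1) iso ltac:(ring); exact: oner_neq0.
have kaE : ka = nu * mu by apply: (mulfI r0); rewrite E2 -E1; ring.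
subst s ka; do 8!right; left.
change_basis (mx3 r^-1 (- nu) 0 0 1 0 0 (- ((mu - nu) / r)) (r ^- 2)) iso
  ltac:(field).
  by rewrite mulf_neq0 // invr_neq0 // expf_neq0.
Qed.

(** The Leibniz identity gives s = 0, mu = (r - 1) nu and r ka = 2 ka. By the second equation y - nu
    c satisfies [x, y] = y = - [y, x] exactly; by the third, r = 2 unless ka = 0. *)
Lemma classify_nonabelian_quotient l mu nu ka r s :
  alg_iso br (product (ideal1_table l 0 1 mu nu ka r s)) ->
  left_leibniz (product (ideal1_table l 0 1 mu nu ka r s)) ->
  non_lie (product (ideal1_table l 0 1 mu nu ka r s)) -> classified.
Proof.
move=> iso leib nlie.
have := leib (col3 1 0 0) (col3 0 1 0) (col3 0 0 1).
rewrite !ideal1_product col3D => /col3_inj[_ _]; scalar_simp => E1.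
have s0 : s = 0 by apply: (addIr (s * r)); rewrite add0r -E1 mulrC.
have := leib (col3 1 0 0) (col3 0 1 0) (col3 1 0 0).
rewrite !ideal1_product col3D => /col3_inj[_ _]; scalar_simp => E2.
have := leib (col3 1 0 0) (col3 0 1 0) (col3 0 1 0).
rewrite !ideal1_product col3D => /col3_inj[_ _]; scalar_simp => E3.
subst s; rewrite !(mul0r, addr0) in E2 E3.
have muE : mu = (r - 1) * nu.
  apply: oppr_inj; apply: (addIr (r * nu)).
  by transitivity (mu * -1 + r * nu); [ring|rewrite E2; ring].
subst mu.
have {E2} l_or_ka_or_r : [|| l != 0, ka != 0 | r != 0].
  apply: contraT; rewrite !negb_or !negbK => /and3P[/eqP l0 /eqP ka0 /eqP r0].
  have [x] := nlie; have [x1 [x2 [x3 ->]]] := col3P x.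
  rewrite ideal1_product l0 ka0 r0 col30 => /eqP[]; congr col3; ring.
have {}iso : alg_iso br (product (ideal1_table l 0 1 0 0 ka r 0)).
  change_basis (mx3 1 0 0 0 1 0 0 (- nu) 1) iso ltac:(ring); exact: oner_neq0.
have [ka0|ka0] := eqVneq ka 0.
  subst ka; have [r0|r0] := eqVneq r 0.
    subst r; rewrite !eqxx /= !orbF in l_or_ka_or_r.
    do 6!right; left.
    change_basis (mx3 1 0 0 0 1 0 0 0 l) iso ltac:(ring) => //.
  do 9!right; left; exists r => //.
  (* The multiple of c added to x turns [x, x] = l c into c. *)
  change_basis (mx3 1 0 0 0 1 0 ((1 - l) / r) 0 1) iso ltac:(field);
    exact: oner_neq0.
have rE : r = 2%:R by apply: (mulIf ka0); rewrite E3; ring.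
subst r; have [ch2|ch2] := boolP (2%N \in [pchar F]).
  have N1 : -1 = 1 :> F by rewrite oppr_pchar2.
  have two0 : 2%:R = 0 :> F by exact: pcharf0 ch2.
  do 7!right; left; split=> //; exists (l / ka).
  rewrite two0 in iso; change_basis (mx3 1 0 0 0 1 0 0 0 ka) iso ltac:(rewrite
    ?N1; field) => //.
have two0 : (2%:R : F) != 0 by rewrite inE /= in ch2.
do 10!right; left; split=> //.
(* Since [x, c] = 2 c, subtracting (l / 2) c from x makes its square zero. *)
change_basis (mx3 1 0 0 0 1 0 (- (l / 2%:R)) 0 ka) iso ltac:(field) => //.
Qed.

Lemma alg_iso_left_leibniz (U V : lmodType F) (mu : U -> U -> U) (nu : V ->
  V -> V) :
  alg_iso mu nu -> left_leibniz mu -> left_leibniz nu.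
Proof.
move=> [f [[g fK gK] fM]] H x y z.
by rewrite -(gK x) -(gK y) -(gK z) -!fM H raddfD.
Qed.

Lemma alg_iso_non_lie (U V : lmodType F) (mu : U -> U -> U) (nu : V -> V -> V) :
  alg_iso mu nu -> non_lie mu -> non_lie nu.
Proof.
move=> [f [[g fK gK] fM]] [x xx0]; exists (f x); rewrite -fM.
by apply: contraNneq xx0 => E; rewrite -(fK (mu x x)) E -(raddf0 f) fK.
Qed.

Lemma classify_ideal1 p q mu nu ka r s : left_leibniz br -> non_lie br ->
  alg_iso br (product (ideal1_table 1 p q mu nu ka r s)) -> classified.
Proof.
move=> leib nlie iso.
have nonab l' mu' nu' ka' r' s' :
    alg_iso br (product (ideal1_table l' 0 1 mu' nu' ka' r' s')) -> classified.
  move=> iso'; apply: (classify_nonabelian_quotient iso').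
    exact: alg_iso_left_leibniz iso' leib.
  exact: alg_iso_non_lie iso' nlie.
have [q0|q0] := eqVneq q 0; last first.
  apply: (nonab (1 / q ^+ 2) ((mu + p / q) / q) ((nu + p / q) / q)
    (ka + p / q * (mu + nu) + (p / q) ^+ 2) (r / q) (s + p / q * r)).
  (* The second vector is [x, y] / q modulo c. *)
  change_basis (mx3 q^-1 (p / q) 0 0 1 0 0 0 1) iso ltac:(field);
    by rewrite invr_neq0.
subst q; have [p0|p0] := eqVneq p 0.
  subst p; apply: (classify_abelian_quotient iso).
  exact: alg_iso_left_leibniz iso leib.
(* Now [x, y] = p x modulo c, so x takes the place of y, and the square of the new first vector is
   no longer normalised to c. *)
apply: (nonab (ka / p ^+ 2) (- (nu / p)) (- (mu / p)) 1 (- (s / p)) r).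
change_basis (mx3 0 1 0 (- p^-1) 0 0 0 0 1) iso ltac:(field).
  by rewrite opprK invr_neq0.
Qed.

End Classification.

(** * From a basis of the abstract algebra to column vectors *)

Section Basis.
Variables (F : fieldType) (L : vectType F).

Definition coords (X : 3.-tuple L) (x : L) : 'cV[F]_3 := \col_i coord X i x.

Lemma coords_is_linear X : linear (coords X).
Proof. by move=> k x y; apply/colP=> i; rewrite !mxE linearP. Qed.

HB.instance Definition _ X :=
  GRing.isLinear.Build F L 'cV[F]_3 _ (coords X) (coords_is_linear X).

Variable br : {bilinear L -> L -> L}.
Variables e1 e2 e3 : L.
Hypotheses (dimL : \dim (fullv : {vspace L}) = 3%N) (free_e : free [:: e1; e2;
  e3]).

Definition comb (v : 'cV[F]_3) : L := v 0 0 *: e1 + v 1 0 *: e2 + v ord_max 0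
  *: e3.

Let X := [tuple e1; e2; e3].

Lemma span_basis : <<X>>%VS = fullv.
Proof.
apply/eqP; rewrite eqEdim subvf /= dimL.
by move: free_e => /eqP ->.
Qed.

Lemma comb_sum v : comb v = \sum_i v i 0 *: X`_i.
Proof.
rewrite !big_ord_recr big_ord0 /= add0r /comb.
by congr (v _ _ *: _ + v _ _ *: _ + v _ _ *: _); exact: val_inj.
Qed.

Lemma coordsK : cancel (coords X) comb.
Proof.
move=> x; rewrite comb_sum;
  have xX : x \in <<X>>%VS by rewrite span_basis memvf.
by rewrite [RHS](coord_span xX); apply: eq_bigr => i _; rewrite mxE.
Qed.

Lemma combK : cancel comb (coords X).
Proof.
move=> v; apply/colP=> i; rewrite mxE comb_sum linear_sum (bigD1 i) //=.
rewrite linearZ /= coord_free // eqxx mulr1 big1 ?addr0 // => j ji.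
by rewrite linearZ /= coord_free // (negPf ji) mulr0.
Qed.

Lemma comb_col3 x y z : comb (col3 x y z) = x *: e1 + y *: e2 + z *: e3.
Proof. by rewrite /comb !mxE. Qed.

Lemma combD u v : comb (u + v) = comb u + comb v.
Proof.
by rewrite /comb !mxE !scalerDl [RHS]addrACA; congr (_ + _); rewrite addrACA.
Qed.

Lemma combZ k u : comb (k *: u) = k *: comb u.
Proof. by rewrite /comb !mxE !scalerDr !scalerA. Qed.

Lemma combP x : exists a b c, x = comb (col3 a b c).
Proof.
by have [a [b [c E]]] := col3P (coords X x); exists a, b, c; rewrite -E coordsK.
Qed.

Lemma alg_iso_basis t :
  [/\ [/\ br e1 e1 = comb (t 1 1),
    br e1 e2 = comb (t 1 2) & br e1 e3 = comb (t 1 3)],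
      [/\ br e2 e1 = comb (t 2 1),
        br e2 e2 = comb (t 2 2) & br e2 e3 = comb (t 2 3)]
    & [/\ br e3 e1 = comb (t 3 1),
      br e3 e2 = comb (t 3 2) & br e3 e3 = comb (t 3 3)]] ->
  alg_iso br (product t).
Proof.
move=> [[E11 E12 E13] [E21 E22 E23] [E31 E32 E33]].
have brE u v : br (comb u) (comb v) = comb (product t u v).
  have [x1 [x2 [x3 ->]]] := col3P u; have [y1 [y2 [y3 ->]]] := col3P v.
  rewrite product_col3 !comb_col3.
  rewrite !(linearDl, linearDr) !(linearZl_LR, linearZr_LR).
  rewrite !combD !combZ -E11 -E12 -E13 -E21 -E22 -E23 -E31 -E32 -E33.
  by rewrite !scalerA.
exists (coords X); split; first by exists comb; [exact: coordsK|exact: combK].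
by move=> x y; apply: (can_inj combK); rewrite /= coordsK -brE !coordsK.
Qed.
End Basis.

(** * Choice of a basis and reduction to the tables *)

Section Reduction.
Variables (F : fieldType) (L : vectType F) (br : {bilinear L -> L -> L}).
Hypothesis dimL : \dim (fullv : {vspace L}) = 3%N.
Hypothesis leib : left_leibniz br.

Lemma square_left_annihilator x z : br (br x x) z = 0.
Proof. by apply: (addIr (br x (br x z))); rewrite add0r -leib. Qed.

Lemma br_polar x y : br x y + br y x = br (x + y) (x + y) - br x x - br y y.
Proof.
apply/esym/eqP; rewrite !subr_eq; apply/eqP.
by rewrite linearDl !linearDr -addrA addrC !addrA.
Qed.

(** By the Leibniz identity [z, [x, x]] is the polarisation of the square at [z, x] and x. This is
    why the squares span an ideal. *)
Lemma br_square z x : br z (br x x) = br (br z x + x) (br z x + x)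
  - br (br z x) (br z x) - br x x.
Proof. by rewrite -br_polar -leib. Qed.

Lemma br_square_left_annihilator z x w : br (br z (br x x)) w = 0.
Proof. by rewrite br_square !linearBl !square_left_annihilator !subr0. Qed.

Lemma exists_free3 (x c : L) : free [:: x; c] -> exists y, free [:: x; y; c].
Proof.
move=> free_xc; have [[y yxc]|all] := pselect (exists y, y \notin <<[:: x;
  c]>>%VS).
  exists y; have /perm_free -> : perm_eq [:: x; y; c] [:: y; x; c].
    by apply/permP => a /=; rewrite addnCA.
  by rewrite free_cons yxc.
have : (fullv <= <<[:: x; c]>>)%VS.
  apply/subvP => y _; apply/negPn/negP => yxc; apply: all; by exists y.
by move/dimvS; rewrite dimL => /leq_trans/(_ (dim_span _)).
Qed.

Lemma leibniz_classification : non_lie br -> classified br.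
Proof.
move=> nlie; have [x c0] := nlie; set c := br x x in c0.
have cl z : br c z = 0 := square_left_annihilator x z.
(* The span of c and d annihilates from the left, whereas [x, x] = c is not zero. *)
have x_notin (d : L) : (forall z, br d z = 0) -> x \notin <<[:: c; d]>>%VS.
  move=> dl; apply/negP; rewrite span_cons span_seq1.
  move=> /memv_addP[u /vlineP[k ->] [v /vlineP[k' ->] E]].
  by move/eqP: c0; apply;
    rewrite /c {1}E linearDl !linearZl_LR /= cl dl !scaler0 addr0.
have free_xc : free [:: x; c].
  rewrite free_cons seq1_free c0 andbT; apply: contra (x_notin c cl) => xc.
  by rewrite span_cons span_seq1 addvv -span_seq1.
have [sq|nsq] := pselect (forall z, exists k, br z z = k *: c).
  have [y fe] := exists_free3 free_xc.
  have cE k : k *: c = comb x y c (col3 0 0 k).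
    by rewrite comb_col3 !scale0r !add0r.
  have zcE z : exists k, br z c = k *: c.
    rewrite /c br_square; have [k1 ->] := sq (br z x + x);
      have [k2 ->] := sq (br z x).
    by exists (k1 - k2 - 1); rewrite !scalerBl scale1r.
  have [p [q [mu xyE]]] := combP dimL fe (br x y).
  have [r rE] := zcE x; have [s sE] := zcE y; have [ka kaE] := sq y.
  (* By polarisation [x, y] + [y, x] is a multiple of c. *)
  have [nu yxE] : exists nu, br y x = comb x y c (col3 (- p) (- q) nu).
    have [k kE] := sq (x + y); exists (k - 1 - ka - mu).
    have -> : br y x = (-1) *: br x y + (k - 1 - ka) *: c.
      rewrite !scalerBl scale1r -kE -kaE -/c -br_polar scaleN1r.
      by rewrite addrA addNr add0r.
    by rewrite xyE cE -combZ -combD col3Z col3D;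
      congr (comb _ _ _ (col3 _ _ _)); ring.
  apply: (@classify_ideal1 _ _ _ p q mu nu ka r s) => //.
  apply: (alg_iso_basis dimL fe);
    rewrite /ideal1_table -cE scale1r -!cE -xyE -yxE.
  have -> : comb x y c 0 = 0 by rewrite col30 -cE scale0r.
  by rewrite !cl.
have [z zE] : exists z, ~ exists k, br z z = k *: c.
  by apply/existsNP.
pose d := br z z.
have dl w : br d w = 0 := square_left_annihilator z w.
have fe : free [:: x; c; d].
  rewrite free_cons x_notin //= -[[:: c; d]]/([:: c] ++ [:: d]).
  have /perm_free -> : perm_eq ([:: c] ++ [:: d]) [:: d;
    c] by apply/permP => a /=; rewrite addnCA.
  rewrite free_cons seq1_free c0 andbT span_seq1.
  by apply/negP => /vlineP; apply: zE.
(* A left annihilator lies in the span of c and d, since an x-component would survive in [u, x].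
   This applies to [x, c] and [x, d]. *)
have xl_comb u : (forall w, br u w = 0) -> exists m n,
  u = comb x c d (col3 0 m n).
  move=> ul; have [a [m [n uE]]] := combP dimL fe u; exists m, n; rewrite uE.
  have : br u x = 0 by [].
  rewrite uE comb_col3 !linearDl !linearZl_LR /= cl dl !scaler0 !addr0 => /eqP.
  by rewrite -/c scaler_eq0 (negPf c0) orbF => /eqP ->; rewrite comb_col3.
have [p [q xcE]] : exists p q, br x c = comb x c d (col3 0 p q).
  by apply: xl_comb; exact: br_square_left_annihilator.
have [m [n xdE]] : exists m n, br x d = comb x c d (col3 0 m n).
  by apply: xl_comb; exact: br_square_left_annihilator.
apply: (@classify_ideal2 _ _ _ p q m n).
  (* If [q] and [n] vanished, [z, z] would be a multiple of c, against the choice of z. *)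
  apply/eqP => -[q0 n0]; apply: zE.
  have [k [a [b E]]] := combP dimL fe z; exists (k * (k + a * p + b * m)).
  rewrite {1}E comb_col3 !linearDl !linearZl_LR /= cl dl !scaler0 !addr0.
  rewrite E comb_col3 !linearDr !linearZr_LR /= -/c xcE xdE q0 n0 !comb_col3.
  by rewrite !scale0r !addr0 !add0r !scalerA -!scalerDl scalerA.
apply: (alg_iso_basis dimL fe); rewrite /ideal2_table !col3E.
have -> : comb x c d (col3 0 0 0) = 0 by rewrite comb_col3 !scale0r !addr0.
have -> : comb x c d (col3 0 1 0) = c by rewrite comb_col3 !scale0r scale1r
  addr0 add0r.
rewrite !(mulr0, mulr1, addr0, add0r) -xcE -xdE.
by split; split; rewrite ?cl ?dl.
Qed.

End Reduction.

Theorem theorem1p1 (F : fieldType) :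
  (forall (L : vectType F) (br : {bilinear L -> L -> L}),
    \dim (fullv : {vspace L}) = 3%N -> left_leibniz br -> non_lie br ->
    alg_iso br L1 \/
    alg_iso br L2 \/
    (exists alpha : F, [/\ alpha != 0, alpha != -1 & alg_iso br (L3 alpha)]) \/
    alg_iso br L4 \/
    (exists2 beta : F, L5_param beta & alg_iso br (L5 beta)) \/
    (exists2 delta : F, L6_param delta & alg_iso br (L6 delta)) \/
    alg_iso br L7 \/
    (2%N \in [pchar F] /\ exists lambda : F, alg_iso br (L8 lambda)) \/
    alg_iso br L9 \/
    (exists2 r : F, r != 0 & alg_iso br (L10 r)) \/
    (2%N \notin [pchar F] /\ alg_iso br L11) \/
    alg_iso br L12 \/
    alg_iso br L13 \/
    (exists2 rho : F, rho != 0 & alg_iso br (L14 rho)) \/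
    alg_iso br L15 \/
    (exists beta gamma : F,
       L16_param beta gamma /\ alg_iso br (L16 beta gamma)))
  /\
  Aut (@L1 F) = [set M | exists a b c d e : F,
    [/\ a != 0, d != 0 &
     M = mx3 a 0 0
             b d 0
             c e (a ^+ 2)]]
  /\
  Aut (@L2 F) = [set M | exists a b c d : F,
    a * (a + b) != 0 /\
    M = mx3 a 0       0
            b (a + b) 0
            c d       (a * (a + b))]
  /\
  (forall alpha : F, alpha != 0 -> alpha != -1 ->
    let S := [set M | exists alpha1 beta2 alpha3 beta3 : F,
      [/\ alpha1 != 0, beta2 != 0 &
       M = mx3 alpha1                              0     0
               ((beta2 - alpha1) / (1 + alpha))    beta2 0
               alpha3                              beta3 (alpha1 * beta2)]] in
    let S' := [set M | exists alpha1 alpha2 alpha3 beta3 : F,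
      alpha1 * (alpha1 + 2%:R * alpha2) != 0 /\
      M = mx3 alpha1 (2%:R * alpha1) 0
              alpha2 (- alpha1)      0
              alpha3 beta3           (alpha1 * (alpha1 + 2%:R * alpha2))] in
    [/\ alpha != 1 -> Aut (L3 alpha) = S,
        alpha = 1 -> Aut (L3 alpha) = S `|` S',
        isog (AutG_mod_a3 (L3 alpha))
          (additive_group F * additive_group F)%type &
        exists K, [/\
          semidirect (AutG (L3 alpha)) (AutG_mod_a3 (L3 alpha)) K,
          alpha != 1 -> isog K (units F * units F)%type &
          alpha = 1 -> exists N H,
            [/\ semidirect K N H, isog N (units F * units F)%type &
                order_two H]]])
  /\
  (Aut (@L4 F) = [set M | exists alpha1 alpha2 alpha3 beta3 : F,
     alpha1 != 0 /\
     M = mx3 alpha1 0      0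
             alpha2 alpha1 0
             alpha3 beta3  (alpha1 ^+ 2)]
   /\ exists N K,
     [/\ semidirect (AutG (@L4 F)) N K,
         isog N (additive_group F * additive_group F)%type &
         isog K (additive_group F * units F)%type])
  /\
  (forall beta : F, L5_param beta ->
    Aut (L5 beta) = [set M | exists a b c d eps : F,
      [/\ (a, b) != (0, 0), eps ^+ 2 = 1 &
       M = mx3 a (- (eps * beta * b)) 0
               b (eps * a)            0
               c d                    (a ^+ 2 + beta * b ^+ 2)]])
  /\
  (forall delta : F, L6_param delta ->
    Aut (L6 delta) = [set M | exists alpha1 alpha2 alpha3 beta3 : F,
      (alpha1, alpha2) != (0, 0) /\
      M = mx3 alpha1 (- (delta * alpha2)) 0
              alpha2 (alpha1 + alpha2)    0
              alpha3 beta3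
                (alpha1 ^+ 2 + alpha1 * alpha2 + delta * alpha2 ^+ 2)]
    /\ forall (E : fieldExtType F) (theta : E),
      <<1%VS; theta>>%VS = fullv -> theta ^+ 2 - theta + delta%:A = 0 ->
      exists N K,
        [/\ semidirect (AutG (L6 delta)) N K,
            isog N (additive_group F * additive_group F)%type &
            isog K (units E)])
  /\
  (Aut (@L7 F) = [set M | exists alpha2 beta2 alpha3 : F,
     beta2 != 0 /\
     M = mx3 1      0     0
             alpha2 beta2 0
             alpha3 0     1]
   /\ exists P Q,
     [/\ direct (AutG (@L7 F)) P Q, isog P (additive_group F) &
         isog Q (scalar_sdprod F)])
  /\
  (2%N \in [pchar F] -> forall lambda : F,
    [/\ Aut (L8 lambda) = [set M | exists alpha2 beta2 alpha3 : F,
          [/\ beta2 != 0, alpha2 ^+ 2 = lambda * (beta2 ^+ 2 - 1) &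
           M = mx3 1      0                0
                   alpha2 beta2            0
                   alpha3 (alpha2 * beta2) (beta2 ^+ 2)]],
        ~ (exists mu : F, lambda = mu ^+ 2) ->
          isog (AutG (L8 lambda)) (additive_group F) &
        (exists mu : F, lambda = mu ^+ 2) ->
          exists N K (phi : additive_group F -> units 'M[F]_3)
                     (psi : units F -> units 'M[F]_3),
          [/\ semidirect (AutG (L8 lambda)) N K,
              isomorphism phi N, isomorphism psi K &
              forall (u : units F) (z : F),
                (psi u * phi z / psi u)%g = phi (uval u ^+ 2 * z)]])
  /\
  (Aut (@L9 F) = [set M | exists alpha2 beta2 gamma3 : F,
     [/\ beta2 != 0, gamma3 != 0 &
      M = mx3 1            0     0
              alpha2       beta2 0
              (gamma3 - 1) 0     gamma3]]
   /\ exists P Q,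
     [/\ direct (AutG (@L9 F)) P Q, isog P (units F) &
         isog Q (scalar_sdprod F)])
  /\
  (forall r : F, r != 0 ->
    Aut (L10 r) = [set M | exists alpha2 beta2 gamma3 : F,
      [/\ beta2 != 0, gamma3 != 0 &
       M = mx3 1                  0     0
               alpha2             beta2 0
               ((gamma3 - 1) / r) 0     gamma3]]
    /\ exists P Q,
      [/\ direct (AutG (L10 r)) P Q, isog P (units F) &
          isog Q (scalar_sdprod F)])
  /\
  (2%N \notin [pchar F] ->
    Aut (@L11 F) = [set M | exists alpha2 beta2 : F,
      beta2 != 0 /\
      M = mx3 1                        0                    0
              alpha2                   beta2                0
              (- (alpha2 ^+ 2 / 2%:R)) (- (alpha2 * beta2)) (beta2 ^+ 2)]
    /\ isog (AutG (@L11 F)) (scalar_sdprod F))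
  /\
  Aut (@L12 F) = [set M | exists a b c : F,
    a != 0 /\
    M = mx3 a 0        0
            b (a ^+ 2) 0
            c (a * b)  (a ^+ 3)]
  /\
  Aut (@L13 F) = [set M | exists b c : F,
    b != -1 /\
    M = mx3 1 0       0
            b (1 + b) 0
            c b       1]
  /\
  (forall rho : F, rho != 0 ->
    [/\ rho = 1 -> isog (AutG (L14 rho)) (units 'M[F]_2),
        rho != 1 -> (2%N \in [pchar F]) || (rho != -1) ->
          isog (AutG (L14 rho)) (units F * units F)%type &
        2%N \notin [pchar F] -> rho = -1 ->
          exists N K (phi : (units F * units F)%type -> units 'M[F]_3),
          [/\ semidirect (AutG (L14 rho)) N K, isomorphism phi N,
              order_two K &
              forall s, K s -> s <> 1%g ->
                forall u v, (s * phi (u, v) / s)%g = phi (v, u)]])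
  /\
  Aut (@L15 F) = [set M | exists a b : F,
    a != 0 /\
    M = mx3 1           0 0
            (a - 1)     a 0
            (b - a + 1) b a]
  /\
  (forall beta gamma : F, L16_param beta gamma ->
    let S := [set M | exists a b : F,
      (a, b) != (0, 0) /\
      M = mx3 1                                0 0
              (b - gamma * (a - 1) / beta)     a (beta * b)
              ((a - 1) / beta)                 b (a + gamma * b)] in
    let S' := [set M | exists a b : F,
      (a, b) != (0, 0) /\
      M = mx3 (-1)             0 0
              (- b)            a (- (beta * b))
              ((1 - a) / beta) b (- a)] in
    [/\ (gamma != 0) || (2%N \in [pchar F]) -> Aut (L16 beta gamma) = S,
        2%N \notin [pchar F] -> gamma = 0 -> Aut (L16 beta gamma) = S `|` S' &
        forall (E : fieldExtType F) (theta : E),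
          <<1%VS; theta>>%VS = fullv ->
          theta ^+ 2 = gamma *: theta + beta%:A ->
          ((gamma != 0) || (2%N \in [pchar F]) ->
             isog (AutG (L16 beta gamma)) (units E)) /\
          (2%N \notin [pchar F] -> gamma = 0 ->
             exists N K, [/\ semidirect (AutG (L16 beta gamma)) N K,
                             isog N (units E) & order_two K])]).
Proof.
split; first by move=> L br dimL leib nlie; exact: leibniz_classification.
split; first exact: Aut_L1.
split; first exact: Aut_L2.
split; first by move=> alpha alpha0 alphaN1 S S'; exact: L3_automorphisms.
split; first by split; [exact: Aut_L4|exact: L4_group].
split; first exact: Aut_L5.
split.
  by move=> delta param; split; [exact: Aut_L6|move=> E theta; exact: L6_group].
split; first by split; [exact: Aut_L7|exact: L7_group].
split.
  move=> ch2 lambda; split; first exact: Aut_L8.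
    exact: L8_nonsquare_group.
  exact: L8_square_group.
split; first by split; [exact: Aut_L9|exact: L9_group].
split; first by move=> r r0; split; [exact: Aut_L10|exact: L10_group].
split; first by move=> ch2; split; [exact: Aut_L11|exact: L11_group].
split; first exact: Aut_L12.
split; first exact: Aut_L13.
split.
  move=> rho rho0; split; first exact: L14_group_1.
    exact: L14_group_generic.
  exact: L14_group_N1.
split; first exact: Aut_L15.
move=> beta gamma param S S'; split.
- move=> gamma2; apply/seteqP; split=> M; last by move=> SM;
  apply/(Aut_L16_cases param); left.
  move=> /(Aut_L16_cases param)[//|[gamma0 two0 _]].
  by move: gamma2; rewrite gamma0 eqxx inE /= (negPf two0).
- move=> ch2 gamma0; apply/seteqP; split=> M.
    by move=> /(Aut_L16_cases param)[|[_ _]]; [left|right].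
  case=> SM; apply/(Aut_L16_cases param); [by left|right; split=> //].
move=> E theta gen theta2; split; first exact: L16_group_plus gen theta2.
exact: L16_group_minus gen theta2.
Qed.
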